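(* Let $\mathbb{K}\in\{\mathbb{R},\mathbb{C},\mathbb{H}\}$, let $\mathcal{O}\subset\mathbb{K}$ be the fixed order described in the context, and let $m\geq 1$. Let $\mathcal{E}_m$ be the space of isometry classes of marked $\mathcal{O}$-lattices of covolume $1$ in $\mathbb{K}^m$. Then the map $$\phi:\mathcal{E}_m\to\mathbb{P}(\mathbb{R}_+^{\mathcal{O}^m}),\qquad [f]\mapsto\big[\,u\mapsto\|f(u)\|\,\big]$$ is a (topological) embedding, i.e. a homeomorphism onto its image.
   Context: $\mathbb{H}$ is the skew field of Hamilton quaternions. $\mathbb{K}^m$ is a right $\mathbb{K}$-vector space, matrices act on the left, and $\langle x,y\rangle=\sum_i\overline{x_i}y_i$ is the standard hermitian product with norm $\|x\|=\sqrt{\langle x,x\rangle}$. $U_m(\mathbb{K})$ is the group of matrices $M\in M_m(\mathbb{K})$ with $MM^*=I_m$, where $M^*={}^t\overline{M}$. The order $\mathcal{O}$: if $\mathbb{K}=\mathbb{R}$, $\mathcal{O}=\mathbb{Z}$; if $\mathbb{K}=\mathbb{C}$, $\mathcal{O}$ is an order in (the ring of integers of) an imaginary quadratic field embedded in $\mathbb{C}$; if $\mathbb{K}=\mathbb{H}$, $\mathcal{O}$ is an order in a quaternion algebra $A$ over $\mathbb{Q}$ that is not split over $\mathbb{R}$, with $A\otimes_{\mathbb{Q}}\mathbb{R}$ identified with $\mathbb{H}$. In all cases $\mathcal{O}$ is a unital subring which is a $\mathbb{Z}$-lattice in the real vector space $\mathbb{K}$. An $\mathcal{O}$-lattice of $\mathbb{K}^m$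 is a right $\mathcal{O}$-submodule generated by a $\mathbb{K}$-basis of $\mathbb{K}^m$; its covolume is the volume of the quotient for the Haar measure of $\mathbb{K}^m$ normalized so that $\mathcal{O}^m$ has covolume $1$. A marked lattice is a morphism of right $\mathcal{O}$-modules $f:\mathcal{O}^m\to\mathbb{K}^m$ whose image is a lattice; its covolume is that of its image. The set of marked lattices of covolume $1$ has the topology induced by the product topology on $(\mathbb{K}^m)^{\mathcal{O}^m}$. $\mathcal{E}_m$ is its quotient (with the quotient topology) by the relation $f\sim k\circ f$, $k\in U_m(\mathbb{K})$. For a set $E$, $\mathbb{P}(\mathbb{R}_+^{E})$ is the quotient of $\mathbb{R}_+^{E}\setminus\{0\}$ ($\mathbb{R}_+=[0,\infty)$, product topology) by homotheties of ratio $>0$, with the quotient topology. *)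

(* Defs.v *)
From HB Require Import structures.
From mathcomp Require Import all_boot all_order all_algebra.
From mathcomp Require Import all_classical all_reals all_analysis.
From mathcomp Require Import generic_quotient complex ring.

Set Implicit Arguments.
Unset Strict Implicit.
Unset Printing Implicit Defensive.

Import Order.TTheory GRing.Theory Num.Theory.
Import numFieldNormedType.Exports.

Local Open Scope classical_set_scope.
Local Open Scope ring_scope.
Local Open Scope quotient_scope.

(* This interface only serves to treat R, C and H uniformly; its three *)
(* instances below are the only ones used. [sre] is the real part, so that *)
(* the square norm of x is [sre (sconj x * x)]. *)
HB.mixin Record isStarAlgebra (R : realType) K
    of GRing.Algebra R K & Topological K := {
  sconj : K -> K;
  sre : K -> R;
  sconj_is_linear : linear sconj;
  sconjM : forall x y, sconj (x * y) = sconj y * sconj x;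
  sconjK : involutive sconj;
  sre_is_scalar : scalar sre;
  sre_mulC : forall x y, sre (x * y) = sre (y * x);
  sre_ge0 : forall x, 0 <= sre (sconj x * x);
  sre_eq0 : forall x, sre (sconj x * x) = 0 -> x = 0
}.

#[short(type="starAlgType")]
HB.structure Definition StarAlgebra (R : realType) :=
  {K of isStarAlgebra R K & GRing.Algebra R K & Topological K}.

Section RealStar.
Context (R : realType).

Let conj_lin : linear (fun x : R^o => x). Proof. by []. Qed.
Let conjM (x y : R^o) : x * y = y * x. Proof. exact: mulrC. Qed.
Let conjK : involutive (fun x : R^o => x). Proof. by []. Qed.
Let re_lin : scalar (fun x : R^o => x : R). Proof. by []. Qed.
Let re_ge0 (x : R^o) : 0 <= (x * x : R).
Proof. by rewrite -expr2 sqr_ge0. Qed.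
Let re_eq0 (x : R^o) : (x * x : R) = 0 -> x = 0.
Proof. by move=> /eqP; rewrite mulf_eq0 orbb => /eqP. Qed.

HB.instance Definition _ := @isStarAlgebra.Build R R^o
  (fun x => x) (fun x => x) conj_lin conjM conjK re_lin conjM re_ge0 re_eq0.

End RealStar.

(* [Rcomplex R] is the library's copy of [R[i]] that is an R-algebra. *)
Section ComplexStar.
Context (R : realType).
Local Notation C := (Rcomplex R).

HB.instance Definition _ := Topological.copy C (R[i])^o.

Let scaleAr (a : R) (x y : C) : a *: (x * y) = x * (a *: y).
Proof. by rewrite mulrC [x * _]mulrC scalerAl. Qed.
HB.instance Definition _ := GRing.Lalgebra_isAlgebra.Build R C scaleAr.

Let conj_lin : linear (conjc : C -> C).
Proof. by move=> a [x y] [z t]; congr (_ +i* _)%C; rewrite opprD mulrN. Qed.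
Let conjM (x y : C) : conjc (x * y) = conjc y * conjc x :> C.
Proof. by rewrite rmorphM mulrC. Qed.
Let conjK : involutive (conjc : C -> C).
Proof. by move=> [x y]; rewrite /= opprK. Qed.
Let re_lin : scalar (fun x : C => complex.Re x).
Proof. by move=> a [x y] [z t]. Qed.
Let re_mulC (x y : C) : complex.Re (x * y) = complex.Re (y * x).
Proof. by rewrite mulrC. Qed.
Let reE (x : C) :
  complex.Re ((conjc x : C) * x) = (complex.Re x) ^+ 2 + (complex.Im x) ^+ 2.
Proof. by case: x => a b /=; ring. Qed.
Let re_ge0 (x : C) : 0 <= complex.Re ((conjc x : C) * x).
Proof. by rewrite reE addr_ge0 ?sqr_ge0. Qed.
Let re_eq0 (x : C) : complex.Re ((conjc x : C) * x) = 0 -> x = 0.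
Proof.
rewrite reE; case: x => a b /= /eqP.
by rewrite paddr_eq0 ?sqr_ge0// !sqrf_eq0 => /andP[/eqP-> /eqP->].
Qed.

HB.instance Definition _ := @isStarAlgebra.Build R C
  (@conjc R) (@complex.Re R) conj_lin conjM conjK re_lin re_mulC re_ge0 re_eq0.

End ComplexStar.

(* [Quat a b c d] is a + b i + c j + d k. *)
Record quaternion (R : Type) := Quat { q1 : R; qi : R; qj : R; qk : R }.

Section QuaternionStar.
Context (R : realType).
Local Notation H := (quaternion R).

Definition quat_coords (x : H) : R * R * R * R := (q1 x, qi x, qj x, qk x).
Definition quat_of (p : R * R * R * R) : H :=
  let: (a, b, c, d) := p in Quat a b c d.
Lemma quat_coordsK : cancel quat_coords quat_of. Proof. by case. Qed.
HB.instance Definition _ := Choice.copy H (can_type quat_coordsK).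

Definition addq (x y : H) :=
  Quat (q1 x + q1 y) (qi x + qi y) (qj x + qj y) (qk x + qk y).
Definition oppq (x : H) := Quat (- q1 x) (- qi x) (- qj x) (- qk x).
Definition mulq (x y : H) :=
  Quat (q1 x * q1 y - qi x * qi y - qj x * qj y - qk x * qk y)
       (q1 x * qi y + qi x * q1 y + qj x * qk y - qk x * qj y)
       (q1 x * qj y - qi x * qk y + qj x * q1 y + qk x * qi y)
       (q1 x * qk y + qi x * qj y - qj x * qi y + qk x * q1 y).
Definition scaleq (a : R) (x : H) :=
  Quat (a * q1 x) (a * qi x) (a * qj x) (a * qk x).
Definition conjq (x : H) := Quat (q1 x) (- qi x) (- qj x) (- qk x).

Local Ltac qring :=
  repeat (case=> ? ? ? ?); rewrite /addq /oppq /mulq /scaleq /conjq /=;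
  congr Quat; ring.

Let addqA : associative addq. Proof. by qring. Qed.
Let addqC : commutative addq. Proof. by qring. Qed.
Let add0q : left_id (Quat 0 0 0 0) addq. Proof. by qring. Qed.
Let addNq : left_inverse (Quat 0 0 0 0) oppq addq. Proof. by qring. Qed.
HB.instance Definition _ := GRing.isZmodule.Build H addqA addqC add0q addNq.

Let mulqA : associative mulq. Proof. by qring. Qed.
Let mul1q : left_id (Quat 1 0 0 0) mulq. Proof. by qring. Qed.
Let mulq1 : right_id (Quat 1 0 0 0) mulq. Proof. by qring. Qed.
Let mulqDl : left_distributive mulq addq. Proof. by qring. Qed.
Let mulqDr : right_distributive mulq addq. Proof. by qring. Qed.
Let oneq_neq0 : Quat 1 0 0 0 != 0 :> H.
Proof. by apply/eqP => -[/eqP]; rewrite oner_eq0. Qed.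
HB.instance Definition _ := GRing.Zmodule_isNzRing.Build H
  mulqA mul1q mulq1 mulqDl mulqDr oneq_neq0.

Let scaleqA a b (x : H) : scaleq a (scaleq b x) = scaleq (a * b) x.
Proof. by move: x; qring. Qed.
Let scale1q : left_id 1 scaleq. Proof. by qring. Qed.
Let scaleqDr : right_distributive scaleq +%R.
Proof. by move=> a; rewrite /GRing.add /=; qring. Qed.
Let scaleqDl (x : H) : {morph scaleq^~ x : a b / a + b}.
Proof. by move: x => [? ? ? ?] a b; congr Quat; rewrite /=; ring. Qed.
HB.instance Definition _ := GRing.Zmodule_isLmodule.Build R H
  scaleqA scale1q scaleqDr scaleqDl.
Let scaleqAl (a : R) (x y : H) : a *: (x * y) = (a *: x) * y.
Proof. by case: x y => ? ? ? ? [? ? ? ?]; congr Quat; rewrite /=; ring. Qed.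
HB.instance Definition _ := GRing.Lmodule_isLalgebra.Build R H scaleqAl.
Let scaleqAr (a : R) (x y : H) : a *: (x * y) = x * (a *: y).
Proof. by case: x y => ? ? ? ? [? ? ? ?]; congr Quat; rewrite /=; ring. Qed.
HB.instance Definition _ := GRing.Lalgebra_isAlgebra.Build R H scaleqAr.

HB.instance Definition _ := Topological.copy H (initial_topology quat_coords).

Let conjq_lin : linear conjq.
Proof. by move=> a [? ? ? ?] [? ? ? ?]; congr Quat; rewrite /=; ring. Qed.
Let conjqM (x y : H) : conjq (x * y) = conjq y * conjq x.
Proof. by case: x y => ? ? ? ? [? ? ? ?]; congr Quat; rewrite /=; ring. Qed.
Let conjqK : involutive conjq.
Proof. by case=> a b c d; rewrite /conjq /= !opprK. Qed.
Let q1_lin : scalar (@q1 R).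
Proof. by move=> a [? ? ? ?] [? ? ? ?]. Qed.
Let q1_mulC (x y : H) : q1 (x * y) = q1 (y * x).
Proof. by case: x y => ? ? ? ? [? ? ? ?] /=; ring. Qed.
Let q1E (x : H) :
  q1 (conjq x * x) = q1 x ^+ 2 + qi x ^+ 2 + qj x ^+ 2 + qk x ^+ 2.
Proof. by case: x => ? ? ? ? /=; ring. Qed.
Let q1_ge0 (x : H) : 0 <= q1 (conjq x * x).
Proof. by rewrite q1E !addr_ge0 ?sqr_ge0. Qed.
Let q1_eq0 (x : H) : q1 (conjq x * x) = 0 -> x = 0.
Proof.
rewrite q1E; case: x => a b c d /= /eqP.
rewrite !paddr_eq0 ?addr_ge0 ?sqr_ge0// !sqrf_eq0.
by move=> /andP[/andP[/andP[/eqP-> /eqP->] /eqP->] /eqP->].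
Qed.

HB.instance Definition _ := @isStarAlgebra.Build R H
  conjq (@q1 R) conjq_lin conjqM conjqK q1_lin q1_mulC q1_ge0 q1_eq0.

End QuaternionStar.

Variant division_algebra := Reals | Complexes | Quaternions.

Definition carrier (R : realType) (t : division_algebra) : starAlgType R :=
  match t with
  | Reals => R^o
  | Complexes => Rcomplex R
  | Quaternions => quaternion R
  end.

Section Orders.
Context {R : realType} {K : starAlgType R}.

Definition Qspan n (b : 'I_n -> K) : set K :=
  [set x | exists c : 'I_n -> rat, x = \sum_i (ratr (c i) : R) *: b i].

Definition is_Rbasis n (b : 'I_n -> K) : Prop :=
  forall x, exists! c : {ffun 'I_n -> R}, x = \sum_i c i *: b i.

(* An order in the Q-algebra A: a unital subring of A that is finitely *)
(* generated as a Z-module and spans A over Q. *)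
Definition is_order_in (A : set K) (O : subringClosed K) : Prop :=
  [/\ forall x, x \in O -> A x,
      exists n (g : 'I_n -> K), forall x,
        x \in O <-> exists c : 'I_n -> int, x = \sum_i g i *~ c i
    & forall x, A x -> exists2 N : nat, (0 < N)%N & x *+ N \in O].

End Orders.

(* The imaginary quadratic fields in C are exactly the Q(sqrt(-d)) with d > 0. *)
Definition imaginary_quadratic_field (R : realType) (L : set (Rcomplex R)) :=
  exists2 d : rat, 0 < d &
    L = [set z | exists a b : rat,
           z = (ratr a +i* (ratr b * Num.sqrt (ratr d)))%C].

(* The Q-subalgebras A of H that are quaternion algebras (a, b / Q), with *)
(* standard Q-basis 1, i, j, ij, such that A (x)_Q R -> H is an isomorphism, *)
(* i.e. 1, i, j, ij is also an R-basis of H; such an A is not split over R. *)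
Definition quaternion_algebra_in (R : realType) (A : set (quaternion R)) :=
  exists (a b : rat) (i j : quaternion R),
    let e := tnth [tuple 1; i; j; i * j] in
    [/\ a != 0 /\ b != 0,
        i * i = (ratr a : R)%:A /\ j * j = (ratr b : R)%:A,
        j * i = - (i * j),
        is_Rbasis e
      & A = Qspan e].

Definition admissible_order (R : realType) (t : division_algebra) :
    subringClosed (carrier R t) -> Prop :=
  match t with
  | Reals => fun O => forall x : R^o, x \in O <-> exists n : int, x = n%:~R
  | Complexes => fun O =>
      exists2 L, imaginary_quadratic_field L & is_order_in L O
  | Quaternions => fun O =>
      exists2 A, quaternion_algebra_in A & is_order_in A O
  end.

Record order_ring (K : nzRingType) (O : subringClosed K) :=
  OrderRing { oval : K; oval_in : oval \in O }.

Section OrderRing.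
Context {K : nzRingType} (O : subringClosed K).
HB.instance Definition _ := [isSub of order_ring O for @oval K O].
HB.instance Definition _ := [Choice of order_ring O by <:].
HB.instance Definition _ := [SubChoice_isSubNzRing of order_ring O by <:].
End OrderRing.

Section Hermitian.
Context {R : realType} {K : starAlgType R}.

Definition adjmx m n (M : 'M[K]_(m, n)) : 'M[K]_(n, m) :=
  \matrix_(i, j) sconj (M j i).

Definition hermitian_product m (x y : 'cV[K]_m) : K :=
  \sum_i sconj (x i 0) * y i 0.

Definition vnorm m (x : 'cV[K]_m) : R :=
  Num.sqrt (sre (hermitian_product x x)).

Definition unitary m (M : 'M[K]_m) : Prop := M *m adjmx M = 1%:M.

(* Matrices over K form a left K-module in the library, hence this separate *)
(* definition of the right one. *)
Definition rscale (L : nzRingType) m (x : 'cV[L]_m) (a : L) : 'cV[L]_m :=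
  \col_i (x i 0 * a).

End Hermitian.

Section HermitianTheory.
Context {R : realType} {K : starAlgType R}.

Lemma sre0 : sre (0 : K) = 0.
Proof.
by have := sre_is_scalar (-1) (0 : K) 0; rewrite scaler0 addr0 mulN1r addNr.
Qed.

Lemma sreD (x y : K) : sre (x + y) = sre x + sre y.
Proof. by have := sre_is_scalar 1 x y; rewrite scale1r mul1r. Qed.

Lemma sre_sum I (r : seq I) (F : I -> K) :
  sre (\sum_(i <- r) F i) = \sum_(i <- r) sre (F i).
Proof. exact: (big_morph _ sreD sre0). Qed.

Lemma sconj0 : sconj (0 : K) = 0.
Proof.
have := sconj_is_linear (-1) (0 : K) 0.
by rewrite scaler0 addr0 scaleN1r addNr.
Qed.

Lemma sconjD (x y : K) : sconj (x + y) = sconj x + sconj y.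
Proof. by have := sconj_is_linear 1 x y; rewrite !scale1r. Qed.

Lemma sconj_sum I (r : seq I) (F : I -> K) :
  sconj (\sum_(i <- r) F i) = \sum_(i <- r) sconj (F i).
Proof. exact: (big_morph _ sconjD sconj0). Qed.

Lemma sconjN (x : K) : sconj (- x) = - sconj x.
Proof. by apply/eqP; rewrite -addr_eq0 -sconjD addNr sconj0. Qed.

Lemma sconj1 : sconj (1 : K) = 1.
Proof. by have := sconjM 1 (sconj (1 : K)); rewrite mul1r sconjK mul1r. Qed.

Lemma adjmxK m n : cancel (@adjmx R K m n) (@adjmx R K n m).
Proof. by move=> M; apply/matrixP => i j; rewrite !mxE sconjK. Qed.

Lemma adjmxM m n p (M : 'M[K]_(m, n)) (N : 'M[K]_(n, p)) :
  adjmx (M *m N) = adjmx N *m adjmx M.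
Proof.
apply/matrixP => i j; rewrite !mxE sconj_sum.
by apply: eq_bigr => k _; rewrite !mxE sconjM.
Qed.

Lemma adjmxB m n (M N : 'M[K]_(m, n)) : adjmx (M - N) = adjmx M - adjmx N.
Proof. by apply/matrixP => i j; rewrite !mxE sconjD sconjN. Qed.

Lemma adjmx1 m : adjmx (1%:M : 'M[K]_m) = 1%:M.
Proof.
apply/matrixP => i j; rewrite !mxE eq_sym.
by case: (i == j); rewrite ?sconj1 ?sconj0.
Qed.

Definition retr m (M : 'M[K]_m) : R := sre (\tr M).

Lemma retrC m n (M : 'M[K]_(m, n)) (N : 'M[K]_(n, m)) :
  retr (M *m N) = retr (N *m M).
Proof.
rewrite /retr /mxtrace !sre_sum.
under eq_bigr do rewrite mxE sre_sum.
under [RHS]eq_bigr do rewrite mxE sre_sum.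
by rewrite exchange_big; do 2!(apply: eq_bigr => ? _); exact: sre_mulC.
Qed.

Lemma retr_adjmx_eq0 m n (M : 'M[K]_(m, n)) : retr (adjmx M *m M) = 0 -> M = 0.
Proof.
rewrite /retr /mxtrace sre_sum.
under eq_bigr do rewrite mxE sre_sum.
under eq_bigr do under eq_bigr do rewrite mxE.
move=> /eqP; rewrite psumr_eq0 => [/allP H|i _]; last first.
  by apply: sumr_ge0 => j _; exact: sre_ge0.
apply/matrixP => i j; rewrite mxE; apply: (@sre_eq0 R).
have := H j (mem_index_enum _); rewrite /= psumr_eq0 => [/allP/(_ i)|k _].
  by rewrite mem_index_enum => /(_ isT)/eqP.
exact: sre_ge0.
Qed.

(* If M M^* = 1 then Q = 1 - M^* M is a self-adjoint idempotent of trace 0. *)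
Lemma unitaryC m (M : 'M[K]_m) : unitary M -> adjmx M *m M = 1%:M.
Proof.
move=> uM; set Q := 1%:M - adjmx M *m M.
have PP : adjmx M *m M *m (adjmx M *m M) = adjmx M *m M.
  by rewrite mulmxA -(mulmxA (adjmx M)) uM mulmx1.
have QQ : adjmx Q *m Q = Q.
  rewrite adjmxB adjmx1 adjmxM adjmxK -/Q.
  by rewrite {2}/Q mulmxBr mulmx1 {2}/Q mulmxBl mul1mx PP subrr subr0.
have : Q = 0.
  apply: retr_adjmx_eq0; rewrite QQ /Q /retr raddfB /=.
  have sreB (x y : K) : sre (x - y) = sre x - sre y.
    by apply/eqP; rewrite eq_sym subr_eq -sreD subrK.
  by rewrite sreB -!/(retr _) (retrC (adjmx M)) uM subrr.
by move/eqP; rewrite subr_eq0 => /eqP.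
Qed.

Lemma unitary1 m : unitary (1%:M : 'M[K]_m).
Proof. by rewrite /unitary adjmx1 mulmx1. Qed.

Lemma unitaryM m (M N : 'M[K]_m) : unitary M -> unitary N -> unitary (M *m N).
Proof.
by move=> uM uN; rewrite /unitary adjmxM mulmxA -(mulmxA M) uN mulmx1.
Qed.

Lemma unitaryV m (M : 'M[K]_m) : unitary M -> unitary (adjmx M).
Proof. by move=> /unitaryC; rewrite /unitary adjmxK. Qed.

Lemma hermitian_productE m (x y : 'cV[K]_m) :
  hermitian_product x y = (adjmx x *m y) 0 0.
Proof. by rewrite mxE; apply: eq_bigr => i _; rewrite mxE. Qed.

Lemma vnorm_unitary m (M : 'M[K]_m) (x : 'cV[K]_m) :
  unitary M -> vnorm (M *m x) = vnorm x.
Proof.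
move=> /unitaryC uM; rewrite /vnorm !hermitian_productE adjmxM.
by rewrite mulmxA -(mulmxA (adjmx x)) uM mulmx1.
Qed.

Lemma vnorm_ge0 m (x : 'cV[K]_m) : 0 <= vnorm x.
Proof. exact: sqrtr_ge0. Qed.

Lemma vnorm_eq0 m (x : 'cV[K]_m) : vnorm x = 0 -> x = 0.
Proof.
move=> /eqP; rewrite /vnorm sqrtr_eq0 => le0; apply: retr_adjmx_eq0.
have -> : retr (adjmx x *m x) = sre (hermitian_product x x).
  by rewrite /retr /mxtrace big_ord1 hermitian_productE.
apply/eqP; rewrite eq_le le0 /hermitian_product sre_sum.
by apply: sumr_ge0 => i _; exact: sre_ge0.
Qed.

End HermitianTheory.

Section Lattices.
Context {R : realType} {K : starAlgType R} (O : subringClosed K) (m : nat).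

Local Notation Om := ('cV[order_ring O]_m).
Local Notation Km := ('cV[K]_m).

Definition Oincl (u : Om) : Km := map_mx (@oval K O) u.

(* The columns of b form a basis of the right K-vector space K^m. *)
Definition is_basis (b : 'M[K]_m) : Prop :=
  forall x : Km, exists! c : Km, x = b *m c.

Definition is_lattice (L : set Km) : Prop :=
  exists2 b, is_basis b & L = [set b *m Oincl u | u in [set: Om]].

(* [g_sigma_algebraType] wants a pointed carrier. *)
Definition pointed_Km : Type := Km.
HB.instance Definition _ := Choice.on pointed_Km.
HB.instance Definition _ := isPointed.Build pointed_Km (0 : Km).
Definition borel_Km :=
  g_sigma_algebraType (@open Km : set (set pointed_Km)).

Definition is_haar (mu : {measure set borel_Km -> \bar R}) : Prop :=
  [/\ forall (x : Km) (A : set borel_Km), measurable A ->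
        mu [set (x + y : Km) | y in A] = mu A,
      forall A : set Km, compact A -> (mu A < +oo)%E
    & forall A : set Km, open A -> A !=set0 -> (0 < mu A)%E].

Definition fundamental_domain (L : set Km) (F : set borel_Km) : Prop :=
  measurable F /\ forall x : Km, exists! l : Km, L l /\ F (x + l).

(* The volume of the quotient of K^m by L is the measure of a Borel *)
(* fundamental domain, which does not depend on the domain. *)
Definition has_covolume (mu : {measure set borel_Km -> \bar R}) (L : set Km)
    (v : \bar R) : Prop :=
  exists2 F, fundamental_domain L F & mu F = v.

Definition normalized_haar (mu : {measure set borel_Km -> \bar R}) : Prop :=
  is_haar mu /\ has_covolume mu (range Oincl) 1%E.

Definition is_marked_lattice (f : Om -> Km) : Prop :=
  [/\ forall u v, f (u + v) = f u + f v,
      forall u (a : order_ring O), f (rscale u a) = rscale (f u) (oval a)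
    & is_lattice (range f)].

Lemma marked_lattice_neq0 (f : Om -> Km) :
  (0 < m)%N -> is_marked_lattice f -> exists u, f u <> 0.
Proof.
move=> m0 [_ _ [b bb fb]].
pose d : Om := \col__ 1.
have [u _ fu] : range f (b *m Oincl d) by rewrite fb; exists d.
exists u; rewrite fu => b0; have [c [_ cU]] := bb 0.
have /matrixP/(_ (Ordinal m0) 0) : Oincl d = 0.
  by rewrite -(cU _ (esym b0)); apply: cU; rewrite mulmx0.
rewrite !mxE (rmorph1 (val : order_ring O -> K) : oval 1 = 1) => /eqP.
by rewrite oner_eq0.
Qed.

End Lattices.
Arguments borel_Km {R} K m.

Section MarkedLattices.
Context {R : realType} {K : starAlgType R} {O : subringClosed K} {m : nat}.
Context (mu : {measure set (borel_Km K m) -> \bar R}).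

Local Notation Om := ('cV[order_ring O]_m).
Local Notation Km := ('cV[K]_m).

Definition marked_lattice1 : set {ptws Om -> Km} :=
  [set f | is_marked_lattice f /\ has_covolume mu (range f) 1%E].

Local Notation X := (set_type marked_lattice1).

Definition isometric : rel X := fun f g =>
  `[< exists2 k : 'M[K]_m, unitary k &
        forall u : Om, set_val g u = k *m (set_val f u : Km) >].

Lemma isometric_equiv : equiv_class_of isometric.
Proof.
split.
- move=> f; apply/asboolP; exists 1%:M; first exact: unitary1.
  by move=> u; rewrite mul1mx.
- have sym (f g : X) : isometric f g -> isometric g f.
    move=> /asboolP[k uk gk]; apply/asboolP; exists (adjmx k).
      exact: unitaryV.
    by move=> u; rewrite gk mulmxA unitaryC// mul1mx.
  by move=> f g; apply/idP/idP; exact: sym.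
- move=> g f h /asboolP[k uk gk] /asboolP[l ul hl].
  apply/asboolP; exists (l *m k); first exact: unitaryM.
  by move=> u; rewrite hl gk mulmxA.
Qed.

Canonical isometric_equiv_rel := EquivRelPack isometric_equiv.

Definition lattice_space := quotient_topology {eq_quot isometric}.

End MarkedLattices.

Section ProjectiveSpace.
Context {R : realType} {E : Type}.

Definition nonneg_cone : set {ptws E -> R} :=
  [set h | (forall u, 0 <= h u :> R) /\ exists u, h u <> 0 :> R].

Local Notation X := (set_type nonneg_cone).

Definition homothetic : rel X := fun g h =>
  `[< exists2 c : R, 0 < c & forall u, set_val h u = c * set_val g u :> R >].

Lemma homothetic_equiv : equiv_class_of homothetic.
Proof.
split.
- by move=> f; apply/asboolP; exists 1 => // u; rewrite mul1r.
- have sym (f g : X) : homothetic f g -> homothetic g f.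
    move=> /asboolP[c c0 gc]; apply/asboolP.
    exists c^-1; first by rewrite invr_gt0.
    by move=> u; rewrite gc mulKf// gt_eqF.
  by move=> f g; apply/idP/idP; exact: sym.
- move=> g f h /asboolP[c c0 gc] /asboolP[d d0 hd].
  apply/asboolP; exists (d * c); first exact: mulr_gt0.
  by move=> u; rewrite hd gc mulrA.
Qed.

Canonical homothetic_equiv_rel := EquivRelPack homothetic_equiv.

Definition projective_cone := quotient_topology {eq_quot homothetic}.

End ProjectiveSpace.
Arguments projective_cone : clear implicits.

Section Phi.
Context {R : realType} {K : starAlgType R} {O : subringClosed K} {m : nat}.
Context (mu : {measure set (borel_Km K m) -> \bar R}).
Context (m_gt0 : (0 < m)%N).

Local Notation Om := ('cV[order_ring O]_m).
Local Notation Km := ('cV[K]_m).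
Local Notation X := (set_type (@marked_lattice1 R K O m mu)).

Lemma norm_marked_cone (f : X) :
  nonneg_cone ((fun u => vnorm (set_val f u : Km)) : {ptws Om -> R}).
Proof.
split=> [u|]; first exact: vnorm_ge0.
have [fm _] := set_valP f.
have [u fu] := marked_lattice_neq0 m_gt0 fm.
by exists u => /vnorm_eq0.
Qed.

Definition norm_marked (f : X) : set_type (@nonneg_cone R Om) :=
  @exist _ (fun h => h \in nonneg_cone) _ (mem_set (norm_marked_cone f)).

Definition phi (q : lattice_space mu) : projective_cone R Om :=
  \pi_(projective_cone R Om) (norm_marked (repr q)).

Lemma phiE (f : X) :
  phi (\pi_(lattice_space mu) f) =
  \pi_(projective_cone R Om) (norm_marked f).
Proof.
apply/eqmodP/asboolP.
have /asboolP[k uk fk] : isometric f (repr (\pi_(lattice_space mu) f)).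
  by apply/eqmodP; rewrite reprK.
exists 1 => // u; rewrite mul1r.
have E (g : X) : set_val (norm_marked g) u = vnorm (set_val g u : Km) by [].
rewrite !E fk vnorm_unitary//.
Qed.

End Phi.

(* The last clause says that the inverse of f on its image is continuous. *)
Definition is_embedding (X Y : topologicalType) (f : X -> Y) : Prop :=
  [/\ injective f,
      continuous f
    & forall U, open U -> exists2 V, open V & f @` U = V `&` range f].

(* Main.v *)
From HB Require Import structures.
Require Import Defs.
From mathcomp Require Import all_boot all_order all_algebra.
From mathcomp Require Import all_classical all_reals all_analysis.
From mathcomp Require Import measurable_realfun generic_quotient complex ring lra.
Set Implicit Arguments.
Unset Strict Implicit.
Unset Printing Implicit Defensive.
Import Order.TTheory GRing.Theory Num.Theory.
Import numFieldNormedType.Exports.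
Local Open Scope classical_set_scope.
Local Open Scope ring_scope.

(** A marked lattice [f] is the restriction to [O^m] of an invertible matrix
    [M], and [u |-> |f u|^2] is the restriction of the positive definite form
    [x |-> |M x|^2] on the real vector space [K^m]. As [O^m] spans this space,
    polarization recovers the form from the norms, and the form determines [M] up
    to a unitary factor on the left ([unitary_of_eq_vnorm]). So the norm function
    determines the class of [f]; what remains is to fix its scale, and to do so
    continuously.

    The scale is fixed by the covolume: if [f] and [g] have covolume 1 and [|g u|
    <= c |f u|] for all [u], then [c >= 1] ([covolume_contraction]). This is shown
    by counting lattice points, using the translation invariance of the Haar
    measure. Write [v r] for the volume of the ball of radius [r]. As the
    translates of a fundamental domain cover [K^m], a lattice of covolume [a] has
    at least about [v r / a] points in this ball ([covering_bound]); as they are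
    disjoint, it has at most about that many ([packing_bound]). Comparing the
    counts ([counting_comparison]) for [f] and [g] gives [v r <= v (c r)] up to an
    arbitrarily small factor and a bounded change of the radius, and this is
    absurd if [c < 1], because tripling the radius at least doubles the volume.
    For [c = 1] the same comparison shows that lattices with the same norm
    function have the same covolume, because [v] does not grow geometrically;
    hence [k f] has covolume 1 whenever [f] has, for [k] unitary
    ([unitary_marked1]).

    Injectivity of [phi] follows from these two facts, and continuity is clear. For
    the continuity of the inverse, let [U] be a saturated open set of markings that
    contains [f]. If the norm of [g] is projectively close to that of [f] on a
    finite set of test vectors, then its Gram matrix is close to that of [f] up to
    a scalar; the covolume forces this scalar to be close to 1, so that [|g u|] is
    close to [|f u|], relative to [|f u|], uniformly in [u]
    ([norms_close_of_projective]). If such [g] existed outside [U] with arbitrarily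
    good approximation, Tychonoff's theorem would provide a cluster point of them
    with exactly the norms of [f]; it is [k f] for some unitary [k], hence lies in
    [U], a contradiction ([saturated_open_norms_close]). *)

(** * The real euclidean structure of K^m *)

Section RealScaling.
Context {R : realType} {K : starAlgType R}.

Lemma sreZ (a : R) (x : K) : sre (a *: x) = a * sre x.
Proof.
by have := sre_is_scalar a x 0; rewrite !addr0 sre0 addr0.
Qed.

Lemma scalar_mulmx n p q (M : 'M[K]_(n, p)) (a : R) (x : 'M[K]_(p, q)) :
  M *m (a%:A *: x) = a%:A *: (M *m x).
Proof.
apply/matrixP => i j; rewrite !mxE mulr_algl scaler_sumr.
by apply: eq_bigr => k _; rewrite mxE mulr_algl scalerAr.
Qed.

Lemma mulmx_sum_rscale n p (M : 'M[K]_(n, p)) (x : 'cV[K]_p) :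
  M *m x = \sum_j rscale (col j M) (x j 0).
Proof.
apply/matrixP => i k; rewrite !mxE summxE.
by apply: eq_bigr => j _; rewrite !mxE ord1.
Qed.

Lemma rscale_mulmx n p (M : 'M[K]_(n, p)) (x : 'cV[K]_p) (a : K) :
  M *m rscale x a = rscale (M *m x) a.
Proof.
apply/matrixP => i j; rewrite !mxE mulr_suml.
by apply: eq_bigr => k _; rewrite !mxE mulrA.
Qed.

End RealScaling.

(** What the three division algebras share beyond the interface of star algebras:
    the real part is invariant under conjugation, so that the real part of the
    hermitian product is symmetric; the dimension over the reals is finite, in the
    form of an expansion of each element along finitely many vectors; and the
    topology is that of the norm. *)
Record parseval_frame (R : realType) (K : starAlgType R) := ParsevalFrame {
  sre_sconj : forall x : K, sre (sconj x) = sre x;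
  frame_dim : nat;
  frame_vec : 'I_frame_dim -> K;
  frame_expand : forall x : K,
    x = \sum_i sre (sconj (frame_vec i) * x) *: frame_vec i;
  nbhs_frame : forall (x : K) (A : set K),
    nbhs x A <-> exists2 e : R, 0 < e &
      forall y, sre (sconj (y - x) * (y - x)) < e -> A y
}.

Section Euclidean.
Context {R : realType} {K : starAlgType R} (frm : parseval_frame K).
Variable m : nat.
Local Notation Km := ('cV[K]_m).
Implicit Types x y z : Km.

Definition ip x y : R := sre (hermitian_product x y).

Lemma ipDr x y z : ip x (y + z) = ip x y + ip x z.
Proof.
rewrite /ip -sreD /hermitian_product -big_split; congr sre.
by apply: eq_bigr => i _; rewrite mxE mulrDr.
Qed.

Lemma ipZr x (a : R) y : ip x (a%:A *: y) = a * ip x y.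
Proof.
rewrite /ip -sreZ /hermitian_product scaler_sumr; congr sre.
by apply: eq_bigr => i _; rewrite mxE mulr_algl -scalerAr.
Qed.

Lemma ipC x y : ip x y = ip y x.
Proof.
rewrite /ip -(sre_sconj frm) /hermitian_product sconj_sum; congr sre.
by apply: eq_bigr => i _; rewrite sconjM sconjK.
Qed.

Lemma ipDl x y z : ip (x + y) z = ip x z + ip y z.
Proof. by rewrite ipC ipDr !(ipC z). Qed.

Lemma ipZl x (a : R) y : ip (a%:A *: x) y = a * ip x y.
Proof. by rewrite ipC ipZr (ipC y). Qed.

Lemma ip0r x : ip x 0 = 0.
Proof. by have := ipZr x 0 0; rewrite scaler0 mul0r. Qed.

Lemma ip_sumr I (r : seq I) (F : I -> Km) x :
  ip x (\sum_(i <- r) F i) = \sum_(i <- r) ip x (F i).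
Proof. exact: (big_morph _ (ipDr x) (ip0r x)). Qed.

Lemma ip_suml I (r : seq I) (F : I -> Km) x :
  ip (\sum_(i <- r) F i) x = \sum_(i <- r) ip (F i) x.
Proof. by rewrite ipC ip_sumr; apply: eq_bigr => i _; rewrite ipC. Qed.

Lemma ip_ge0 x : 0 <= ip x x.
Proof.
by rewrite /ip /hermitian_product sre_sum sumr_ge0// => i _; exact: sre_ge0.
Qed.

Lemma vnorm_sqr x : vnorm x ^+ 2 = ip x x.
Proof. by rewrite sqr_sqrtr// ip_ge0. Qed.

Lemma vnorm0 : vnorm (0 : Km) = 0.
Proof. by rewrite /vnorm -/(ip _ _) ip0r sqrtr0. Qed.

Lemma vnorm_gt0 x : x != 0 -> 0 < vnorm x.
Proof.
move=> x0; rewrite lt_neqAle vnorm_ge0 andbT eq_sym.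
by apply: contra_neq x0 => /vnorm_eq0.
Qed.

Lemma vnormZ (a : R) x : vnorm (a%:A *: x) = `|a| * vnorm x.
Proof.
by rewrite /vnorm -!/(ip _ _) ipZr ipZl mulrA sqrtrM -?expr2 ?sqr_ge0// sqrtr_sqr.
Qed.

Lemma vnormN x : vnorm (- x) = vnorm x.
Proof. by rewrite -scaleN1r -(scaleN1r 1) vnormZ normrN normr1 mul1r. Qed.

Lemma vnorm_distC x y : vnorm (x - y) = vnorm (y - x).
Proof. by rewrite -vnormN opprB. Qed.

(** The square norm of [|y|^2 x - <x,y> y] is nonnegative. *)
Lemma cauchy_schwarz x y : `|ip x y| <= vnorm x * vnorm y.
Proof.
rewrite -ler_sqr ?nnegrE ?mulr_ge0 ?vnorm_ge0// real_normK ?num_real//.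
rewrite exprMn !vnorm_sqr.
have [->|y0] := eqVneq y 0; first by rewrite !ip0r mulr0 expr0n.
have yy : 0 < ip y y by rewrite -vnorm_sqr exprn_gt0// vnorm_gt0.
have := ip_ge0 ((ip y y)%:A *: x + (- ip x y)%:A *: y).
rewrite ipDl !ipDr !ipZl !ipZr (ipC y x) => H.
rewrite [X in 0 <= X](_ : _ = ip y y * (ip x x * ip y y - ip x y ^+ 2)) in H; last by ring.
by rewrite pmulr_rge0// subr_ge0 in H.
Qed.

Lemma vnormD x y : vnorm (x + y) <= vnorm x + vnorm y.
Proof.
rewrite -ler_sqr ?nnegrE ?addr_ge0 ?vnorm_ge0// vnorm_sqr sqrrD !vnorm_sqr.
rewrite ipDl !ipDr (ipC y x).
have := le_trans (ler_norm _) (cauchy_schwarz x y); lra.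
Qed.

Lemma vnormB_le x y z : vnorm (x - z) <= vnorm (x - y) + vnorm (y - z).
Proof. by apply: le_trans (vnormD _ _); rewrite addrA subrK. Qed.

Lemma vnorm_dist x y : `|vnorm x - vnorm y| <= vnorm (x - y).
Proof.
have H (u v : Km) : vnorm u - vnorm v <= vnorm (u - v).
  by rewrite lerBlDr; apply: le_trans (vnormD _ _); rewrite subrK.
by rewrite ler_norml H andbT lerNl opprB vnorm_distC H.
Qed.

Lemma vnorm_sum I (r : seq I) (F : I -> Km) :
  vnorm (\sum_(i <- r) F i) <= \sum_(i <- r) vnorm (F i).
Proof.
elim/big_rec2: _ => [|i y x _ H]; first by rewrite vnorm0.
by apply: le_trans (vnormD _ _) _; rewrite lerD2l.
Qed.

Lemma polarization x y :
  ip x y = (vnorm (x + y) ^+ 2 - vnorm x ^+ 2 - vnorm y ^+ 2) / 2.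
Proof.
by rewrite !vnorm_sqr ipDl !ipDr (ipC y x); field.
Qed.

Local Notation J := ('I_m * 'I_(frame_dim frm))%type.

Definition col_frame (j : J) : Km :=
  \col_k if k == j.1 then frame_vec j.2 else 0.

Lemma ip_col_frame j x : ip (col_frame j) x = sre (sconj (frame_vec j.2) * x j.1 0).
Proof.
rewrite /ip /hermitian_product (bigD1 j.1)//= mxE eqxx big1 ?addr0// => k kj.
by rewrite mxE (negPf kj) sconj0 mul0r.
Qed.

Lemma col_frame_expand x : x = \sum_j (ip (col_frame j) x)%:A *: col_frame j.
Proof.
apply/colP => k; rewrite summxE.
rewrite -(pair_bigA _ (fun i l => ((ip (col_frame (i, l)) x)%:A *: col_frame (i, l)) k 0))/=.
rewrite (bigD1 k)//= [X in _ + X]big1 ?addr0 => [|i ik]; last first.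
  by apply: big1 => l _; rewrite !mxE/= eq_sym (negPf ik) mulr0.
rewrite {1}[x k 0](@frame_expand _ _ frm); apply: eq_bigr => l _.
by rewrite !mxE/= eqxx mulr_algl ip_col_frame.
Qed.

End Euclidean.

Section BoundedOperators.
Context {R : realType} {K : starAlgType R} (frm : parseval_frame K).
Variables m p : nat.

Definition real_linear (T : 'cV[K]_m -> 'cV[K]_p) :=
  (forall x y, T (x + y) = T x + T y) /\
  (forall (a : R) x, T (a%:A *: x) = a%:A *: T x).

Lemma real_linear0 T : real_linear T -> T 0 = 0.
Proof. by move=> [_ /(_ 0 0)]; rewrite !scale0r. Qed.

Lemma real_linear_sum T I (r : seq I) (F : I -> 'cV[K]_m) : real_linear T ->
  T (\sum_(i <- r) F i) = \sum_(i <- r) T (F i).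
Proof. by move=> lT; apply: (big_morph _ lT.1 (real_linear0 lT)). Qed.

(** Bound [T] on the finitely many vectors of the frame. *)
Lemma real_linear_bounded T : real_linear T ->
  exists2 C : R, 0 < C & forall x, vnorm (T x) <= C * vnorm x.
Proof.
move=> lT.
pose C := \sum_j vnorm (@col_frame R K frm m j) * vnorm (T (col_frame j)).
have C0 : 0 <= C by apply: sumr_ge0 => j _; rewrite mulr_ge0 ?vnorm_ge0.
exists (C + 1); first by rewrite ltr_wpDl.
move=> x; apply: (@le_trans _ _ (C * vnorm x)); last first.
  by rewrite ler_wpM2r ?vnorm_ge0// lerDl.
rewrite {1}[x](col_frame_expand frm) (real_linear_sum _ _ lT).
apply: le_trans (vnorm_sum frm _ _) _; rewrite mulr_suml.
apply: ler_sum => j _; rewrite lT.2 vnormZ// mulrAC ler_wpM2r ?vnorm_ge0//.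
exact: (cauchy_schwarz frm).
Qed.

Lemma mulmx_real_linear (M : 'M[K]_(p, m)) : real_linear (mulmx M).
Proof. by split=> [x y|a x]; [rewrite mulmxDr | rewrite scalar_mulmx]. Qed.

End BoundedOperators.

Lemma rscale_real_linear {R : realType} {K : starAlgType R} m (a : K) :
  @real_linear R K m m (fun x => rscale x a).
Proof.
split=> [x y|b x]; apply/colP => i; rewrite !mxE ?mulrDl//.
by rewrite !mulr_algl scalerAl.
Qed.

(** * The norm topology of K^m *)

Lemma finite_common_bound (R : realType) (I : finType) (P : I -> R -> Prop) :
  (forall i e e', 0 < e' -> e' <= e -> P i e -> P i e') ->
  (forall i, exists2 e, 0 < e & P i e) ->
  exists2 e, 0 < e & forall i, P i e.
Proof.
move=> mono H.
suff [e e0 He] : exists2 e, 0 < e & forall i, i \in enum I -> P i e.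
  by exists e => // i; apply: He; rewrite mem_enum.
elim: (enum I) => [|i s [e e0 IH]]; first by exists 1.
have [e' e'0 Pe'] := H i.
have min0 : 0 < Num.min e e' by rewrite lt_min e0.
exists (Num.min e e') => // k; rewrite inE => /predU1P[->|ks].
  by apply: mono Pe' => //; rewrite ge_min lexx orbT.
by apply: mono (IH _ ks) => //; rewrite ge_min lexx.
Qed.

Lemma compact_ptws_box (I : eqType) (T : topologicalType) (A : I -> set T) :
  (forall i, compact (A i)) ->
  compact [set f : {ptws I -> T} | forall i, A i (f i)].
Proof. exact: (@tychonoff I (fun=> T) A). Qed.

Lemma ptws_eval_continuous (I : eqType) (T : topologicalType) (i : I) :
  continuous (fun f : {ptws I -> T} => f i).
Proof. exact: (@proj_continuous I (fun=> T) i). Qed.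

Lemma nbhs_ptws_box (R : realType) (I : finType) (c : {ptws I -> R}) (d : R) :
  0 < d -> nbhs c [set c' : {ptws I -> R} | forall i, `|c' i - c i| < d].
Proof.
move=> d0; apply: (@filter_forall {ptws I -> R} I
  (fun i => [set c' : {ptws I -> R} | `|c' i - c i| < d]) (nbhs c)) => i.
apply: (@ptws_eval_continuous I R i c [set t | `|t - c i| < d]).
by apply/nbhs_ballP; exists d => //= y; rewrite /ball/= distrC.
Qed.

Section VectorTopology.
Context {R : realType} {K : starAlgType R} (frm : parseval_frame K) (m : nat).
Local Notation Km := ('cV[K]_m).
Local Notation J := ('I_m * 'I_(frame_dim frm))%type.

Lemma nbhs_vnormP (x : Km) (A : set Km) :
  nbhs x A <-> exists2 e : R, 0 < e & forall y, vnorm (y - x) < e -> A y.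
Proof.
have lt_vnorm (z : Km) (e : R) : 0 < e ->
    (vnorm z < e) = (\sum_i sre (sconj (z i 0) * z i 0) < e ^+ 2).
  move=> e0; rewrite -ltr_sqr ?nnegrE ?vnorm_ge0 ?ltW//.
  by rewrite (vnorm_sqr z) /ip /hermitian_product sre_sum.
split=> [[P Px PA]|[e e0 eA]].
  have [e e0 eP] : exists2 e : R, 0 < e & forall i (y : K),
      sre (sconj (y - x i 0) * (y - x i 0)) < e ^+ 2 -> P i 0 y.
    apply: finite_common_bound => [i e e' e'0 e'e Pe y ye|i].
      apply: Pe; apply: lt_le_trans ye _.
      by rewrite ler_sqr// nnegrE ltW// (lt_le_trans e'0).
    have [e e0 He] := (nbhs_frame frm _ _).1 (Px i 0).
    exists (Num.sqrt e); first by rewrite sqrtr_gt0.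
    by move=> y; rewrite sqr_sqrtr ?ltW//; apply: He.
  exists e => // y; rewrite lt_vnorm// => ye; apply: PA => i j.
  rewrite ord1; apply: eP; apply: le_lt_trans ye.
  rewrite (bigD1 i)//= !mxE lerDl sumr_ge0// => k _; exact: sre_ge0.
pose d := e ^+ 2 / m.+1%:R.
have d0 : 0 < d by rewrite divr_gt0// exprn_gt0.
exists (fun i _ => [set y | sre (sconj (y - x i 0) * (y - x i 0)) < d]).
  by move=> i j; apply/(nbhs_frame frm); exists d => //; rewrite ord1.
move=> y yx; apply: eA; rewrite lt_vnorm//.
apply: (@le_lt_trans _ _ (\sum_(i < m) d)).
  by apply: ler_sum => i _; have := yx i 0; rewrite !mxE => /ltW.
rewrite sumr_const card_ord -mulr_natr /d mulrAC ltr_pdivrMr// ltr_pM2l ?exprn_gt0//.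
by rewrite ltr_nat.
Qed.

Lemma open_vnormP (A : set Km) :
  open A <-> forall x, A x ->
    exists2 e : R, 0 < e & forall y, vnorm (y - x) < e -> A y.
Proof.
rewrite openE; split=> H x /H; first by move/nbhs_vnormP.
by move=> ?; apply/nbhs_vnormP.
Qed.

Lemma open_vball (x : Km) (r : R) : open [set y : Km | vnorm (y - x) < r].
Proof.
apply/open_vnormP => y /= yr; exists (r - vnorm (y - x)); first by rewrite subr_gt0.
move=> z zy; have := vnormB_le frm z y x; lra.
Qed.

Lemma vnorm_continuous : continuous (@vnorm R K m).
Proof.
move=> x A /= /nbhs_ballP[e /= e0 eA]; apply/nbhs_vnormP; exists e => //.
move=> y yx; apply: eA; rewrite /ball/= distrC.
exact: le_lt_trans (vnorm_dist frm _ _) yx.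
Qed.

Lemma closed_vball_closed (r : R) : closed [set y : Km | vnorm y <= r].
Proof.
rewrite -openC (_ : ~` _ = [set y | r < vnorm y]); last first.
  by apply/seteqP; split=> y /=; rewrite ltNge => /negP.
apply/open_vnormP => y /= yr; exists (vnorm y - r); first by rewrite subr_gt0.
move=> z zy; have := le_trans (ler_norm _) (vnorm_dist frm y z).
rewrite (vnorm_distC frm y z); lra.
Qed.

(** The ball is closed inside the image of a cube of coordinates in the frame,
    and that cube is compact. *)
Lemma closed_vball_compact (r : R) : compact [set y : Km | vnorm y <= r].
Proof.
pose b := @col_frame R K frm m.
pose synth (c : {ptws J -> R}) : Km := \sum_j (c j)%:A *: b j.
pose I j := `[- (vnorm (b j) * r), vnorm (b j) * r]%R.
have cube : compact [set c : {ptws J -> R} | forall j, [set` I j] (c j)].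
  by apply: (@compact_ptws_box J R (fun j => [set` I j])) => j; exact: segment_compact.
have synth_cont : continuous synth.
  move=> c A /nbhs_vnormP[e e0 eA].
  pose d := e / (\sum_j vnorm (b j) + 1).
  have s0 : 0 <= \sum_j vnorm (b j) by apply: sumr_ge0 => j _; exact: vnorm_ge0.
  have d0 : 0 < d by rewrite divr_gt0// ltr_wpDl.
  have H := nbhs_ptws_box c d0.
  apply: filterS H => c' Hc'; apply: eA; rewrite /synth -sumrB.
  apply: le_lt_trans (vnorm_sum frm _ _) _.
  apply: (@le_lt_trans _ _ (d * \sum_j vnorm (b j))); last first.
    by rewrite mulrAC ltr_pdivrMr ?ltr_wpDl// ltr_pM2l// ltrDl.
  rewrite mulr_sumr; apply: ler_sum => j _.
  rewrite -scalerBl -scalerBl vnormZ// ler_wpM2r ?vnorm_ge0// ltW//.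
apply: (@subclosed_compact _ _ (synth @` [set c | forall j, [set` I j] (c j)])).
- exact: closed_vball_closed.
- by apply: continuous_compact cube; exact: continuous_subspaceT.
- move=> x /= xr; exists (fun j => ip (b j) x) => /=; last exact: (esym (col_frame_expand frm x)).
  move=> j; rewrite in_itv/= -ler_norml.
  apply: le_trans (cauchy_schwarz frm _ _) _.
  by rewrite ler_wpM2l ?vnorm_ge0.
Qed.

End VectorTopology.

(** * The three division algebras *)

Section Instances.
Context {R : realType}.

Lemma sqr_lt_sqrt (a e : R) : 0 < e -> (a * a < e) = (`|a| < Num.sqrt e).
Proof.
move=> e0; rewrite -[in RHS]ltr_sqr ?nnegrE ?sqrtr_ge0// sqr_sqrtr ?ltW//.
by rewrite real_normK ?num_real.
Qed.

Lemma real_frame : parseval_frame (carrier R Reals).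
Proof.
have sqE (z : R^o) : sre (sconj z * z) = z * z by [].
apply: (@ParsevalFrame R (carrier R Reals) _ 1%N (fun=> 1)) => //=.
- by move=> x; rewrite big_ord1 /= /sconj /sre/= mul1r -[_ *: _]/(_ * _) mulr1.
- move=> x A; split.
    move=> /nbhs_ballP[e /= e0 eA]; exists (e ^+ 2); first by rewrite exprn_gt0.
    move=> y; rewrite sqE.
    rewrite sqr_lt_sqrt ?exprn_gt0// sqrtr_sqr (gtr0_norm e0)// => yx; apply: eA.
    by rewrite /ball/= distrC.
  move=> [e e0 eA]; apply/nbhs_ballP; exists (Num.sqrt e); first by rewrite /= sqrtr_gt0.
  move=> y /= yx; apply: eA; rewrite sqE.
  by rewrite sqr_lt_sqrt// distrC.
Qed.

Lemma complex_frame : parseval_frame (carrier R Complexes).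
Proof.
have sqE (z : Rcomplex R) : sre (sconj z * z) = complex.Re z ^+ 2 + complex.Im z ^+ 2.
  by case: z => a b; rewrite /sre/sconj/=; ring.
apply: (@ParsevalFrame R (carrier R Complexes) _ 2%N
  (fun i => if i == 0 then 1 else ('i)%C)) => //=.
- by case.
- move=> [a b]; rewrite !big_ord_recl big_ord0 /=.
  rewrite /sre/sconj/= !mul0r !mul1r !oppr0 ?mul0r ?subr0 ?addr0 ?sub0r ?add0r ?mulN1r ?opprK.
  by congr (_ +i* _)%C; rewrite /= ?mulr1 ?mulr0 ?addr0 ?add0r.
- move=> x A; split.
    move=> /nbhs_ballP[e /= e0 eA].
    have [r r0 er] : exists2 r : R, 0 < r & (r%:C = e)%C.
      case: e e0 {eA} => r s; rewrite ltcE/= => /andP[/eqP-> r0].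
      by exists r.
    exists (r ^+ 2); first by rewrite exprn_gt0.
    move=> y; rewrite sqE => yr; apply: eA; rewrite -ball_normE/= distrC -er.
    rewrite normc_def ltcR -(gtr0_norm r0) -sqrtr_sqr ltr_sqrt ?exprn_gt0//.
  move=> [e e0 eA]; apply/nbhs_ballP; exists ((Num.sqrt e)%:C)%C.
    by rewrite /= ltcR sqrtr_gt0.
  move=> y; rewrite -ball_normE /= distrC normc_def ltcR ltr_sqrt// => yx.
  by apply: eA; rewrite sqE.
Qed.

Lemma quaternion_frame : parseval_frame (carrier R Quaternions).
Proof.
have sqE (z : quaternion R) :
    sre (sconj z * z) = q1 z ^+ 2 + qi z ^+ 2 + qj z ^+ 2 + qk z ^+ 2.
  by case: z => a b c d; rewrite /sre/sconj/=; ring.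
apply: (@ParsevalFrame R (carrier R Quaternions) _ 4%N
  (tnth [tuple Quat 1 0 0 0; Quat 0 1 0 0; Quat 0 0 1 0; Quat 0 0 0 1])) => //=.
- move=> [a b c d]; rewrite !big_ord_recl big_ord0 !(tnth_nth 0)/=.
  by congr Quat; rewrite /sre/sconj/=; ring.
- move=> x A; split.
    move=> [_ [[B oB <-] /= Bx BA]].
    have /nbhs_ballP[e /= e0 eB] : nbhs (quat_coords x) B.
      by apply: open_nbhs_nbhs.
    exists (e ^+ 2); first by rewrite exprn_gt0.
    move=> y; rewrite sqE => yx; apply: BA; apply: eB.
    case: x y yx {Bx} => [a b c d] [a' b' c' d'] /= yx.
    have le_e (s t : R) : (s - t) ^+ 2 < e ^+ 2 -> `|t - s| < e.
      by rewrite expr2 sqr_lt_sqrt ?exprn_gt0// sqrtr_sqr (gtr0_norm e0) distrC.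
    have := sqr_ge0 (a' - a); have := sqr_ge0 (b' - b).
    have := sqr_ge0 (c' - c); have := sqr_ge0 (d' - d) => h1 h2 h3 h4.
    by do 3?split; apply: le_e; rewrite /=; lra.
  move=> [e e0 eA].
  pose B := ball (quat_coords x) (Num.sqrt (e / 4)).
  have B0 : 0 < Num.sqrt (e / 4) by rewrite sqrtr_gt0 divr_gt0.
  exists (@quat_coords R @^-1` B°); split.
  - by exists B° => //; exact: open_interior.
  - rewrite /= /interior; exact: nbhsx_ballx.
  - move=> y /= /interior_subset; case: x y eA @B => [a b c d] [a' b' c' d'] /= eA.
    have lt4 (s t : R) : `|s - t| < Num.sqrt (e / 4) -> (t - s) ^+ 2 < e / 4.
      by rewrite expr2 sqr_lt_sqrt ?divr_gt0// distrC.
    move=> [[[/= /lt4 h1 /lt4 h2] /lt4 h3] /lt4 h4].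
    by apply: eA; rewrite sqE/=; lra.
Qed.

End Instances.

(** * Orders are countable and span over the reals *)

Section OrderLattice.
Context {R : realType} {K : starAlgType R} (O : subringClosed K).

Definition real_spanning n (g : 'I_n -> order_ring O) :=
  forall x : K, exists c : 'I_n -> R, x = \sum_i c i *: oval (g i).

(** Each element of the algebra has a positive multiple in the order. *)
Lemma order_real_spanning (A : set K) n (e : 'I_n -> K) :
  is_order_in A O -> (forall i, A (e i)) ->
  (forall x, exists c : 'I_n -> R, x = \sum_i c i *: e i) ->
  exists g : 'I_n -> order_ring O, real_spanning g.
Proof.
move=> [_ _ AO] Ae e_span.
have /choice[N HN] : forall i, exists N : nat, (0 < N)%N /\ e i *+ N \in O.
  by move=> i; have [N N0 eN] := AO _ (Ae i); exists N.
exists (fun i => OrderRing (HN i).2) => x.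
have [c ->] := e_span x; exists (fun i => c i / (N i)%:R).
apply: eq_bigr => i _ /=; have -> : e i *+ N i = ((N i)%:R : R) *: e i by rewrite scaler_nat.
rewrite scalerA divfK//.
by rewrite pnatr_eq0 -lt0n (HN i).1.
Qed.

Lemma order_countable (A : set K) : is_order_in A O ->
  exists (T : countType) (h : order_ring O -> T), injective h.
Proof.
move=> [_ [n [g HO]] _].
have /choice[c Hc] : forall x : order_ring O, exists c : {ffun 'I_n -> int},
    oval x = \sum_i g i *~ c i.
  move=> x; have [c ->] := (HO _).1 (oval_in x).
  by exists [ffun i => c i]; apply: eq_bigr => i _; rewrite ffunE.
exists {ffun 'I_n -> int}, c => x y cxy.
by apply: val_inj; rewrite /= !Hc cxy.
Qed.

(** The translates of a fundamental domain by a lattice have to be enumerated in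
    order to add up their measures. *)
Lemma col_countable m :
  (exists (T : countType) (h : order_ring O -> T), injective h) ->
  exists h : 'cV[order_ring O]_m -> nat, injective h.
Proof.
move=> [T [h hI]].
exists (fun u => pickle [ffun i => h (u i 0)]) => u v /(pcan_inj pickleK)/ffunP uv.
by apply/colP => i; apply: hI; have := uv i; rewrite !ffunE.
Qed.

Lemma col_real_spanning n (g : 'I_n -> order_ring O) m :
  real_spanning g ->
  forall x : 'cV[K]_m, exists c : 'I_m * 'I_n -> R,
    x = \sum_j (c j)%:A *: Oincl (\col_k if k == j.1 then g j.2 else 0).
Proof.
move=> gs x; have /choice[c Hc] := fun i : 'I_m => gs (x i 0).
exists (fun j => c j.1 j.2); apply/colP => k; rewrite summxE.
rewrite -(pair_bigA _ (fun i l => ((c i l)%:A *: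
  Oincl (\col_k if k == i then g l else 0)) k 0))/=.
rewrite (bigD1 k)//= [X in _ + X]big1 ?addr0 => [|i ik]; last first.
  apply: big1 => l _; rewrite !mxE/= eq_sym (negPf ik).
  by rewrite (raddf0 (val : order_ring O -> K) : oval 0 = 0) mulr0.
rewrite {1}Hc; apply: eq_bigr => l _.
by rewrite !mxE/= eqxx mulr_algl.
Qed.

End OrderLattice.

Section Admissible.
Context {R : realType}.

Lemma admissible_countable t (O : subringClosed (carrier R t)) :
  admissible_order O ->
  exists (T : countType) (h : order_ring O -> T), injective h.
Proof.
case: t O => O /=.
- move=> HO.
  have /choice[c Hc] : forall x : order_ring O, exists n : int, oval x = n%:~R.
    by move=> x; apply/(HO _).1/oval_in.
  by exists int, c => x y cxy; apply: val_inj; rewrite /= !Hc cxy.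
- by move=> [A _]; exact: order_countable.
- by move=> [A _]; exact: order_countable.
Qed.

Lemma admissible_spanning t (O : subringClosed (carrier R t)) :
  admissible_order O ->
  exists n (g : 'I_n -> order_ring O), real_spanning g.
Proof.
case: t O => O /=.
- move=> _; exists 1%N, (fun=> 1) => x; exists (fun=> x).
  rewrite big_ord1 (rmorph1 (val : order_ring O -> R^o) : oval 1 = 1).
  by rewrite -[_ *: _]/(_ * _) mulr1.
- move=> [A [d d0 AE] hO]; exists 2%N.
  have sd0 : Num.sqrt (ratr d) != 0 :> R by rewrite gt_eqF// sqrtr_gt0 ltr0q.
  pose e (i : 'I_2) : Rcomplex R :=
    if i == 0 then 1 else (0 +i* Num.sqrt (ratr d))%C.
  apply: (@order_real_spanning R (Rcomplex R) O A 2 e hO).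
    move=> i; rewrite AE /e; case: ifP => _.
      by exists 1, 0; rewrite rmorph1 rmorph0 mul0r.
    by exists 0, 1; rewrite rmorph1 rmorph0 mul1r.
  move=> [a b]; exists (fun i => if i == 0 then a else b / Num.sqrt (ratr d)).
  rewrite !big_ord_recl big_ord0 /e /=.
  by congr (_ +i* _)%C; rewrite /= ?mulr1 ?mulr0 ?addr0 ?add0r ?divfK.
- move=> [A [a [b [i [j]]]]] /=; set e := tnth _ => -[_ _ _ eb AE] hO.
  exists 4%N; apply: (@order_real_spanning R (quaternion R) O A 4 e hO).
    move=> k; rewrite AE; exists (fun l => (l == k)%:R).
    rewrite (bigD1 k)//= big1 ?addr0 => [|l lk]; last first.
      by rewrite (negPf lk) rmorph0 scale0r.
    by rewrite eqxx rmorph1 scale1r.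
  by move=> x; have [c [xc _]] := eb x; exists c.
Qed.

End Admissible.

(** * The matrix of a marked lattice *)

Definition invertible_mx (K : nzRingType) m (M : 'M[K]_m) :=
  exists N, M *m N = 1%:M /\ N *m M = 1%:M.

Section Inverse.
Context {R : realType} {K : starAlgType R} (frm : parseval_frame K) (m : nat).
Local Notation J := ('I_m * 'I_(frame_dim frm))%type.
Local Notation b := (@col_frame R K frm m).
Implicit Types M N : 'M[K]_m.

Lemma eq_mulmx_col M N : (forall x : 'cV[K]_m, M *m x = N *m x) -> M = N.
Proof.
move=> MN; apply/matrixP => i j; have /colP/(_ i) := MN (delta_mx j 0).
by rewrite -!colE !mxE.
Qed.

Definition frame_matrix M : 'M[R]_(#|{: J}|) :=
  \matrix_(i, j) ip (b (enum_val i)) (M *m b (enum_val j)).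

Lemma mulmx_frame_expand M (x : 'cV[K]_m) :
  M *m x = \sum_(j : J) (ip (b j) x)%:A *: (M *m b j).
Proof.
rewrite {1}[x](col_frame_expand frm) mulmx_sumr.
by apply: eq_bigr => j _; rewrite scalar_mulmx.
Qed.

Lemma frame_matrixM M N :
  frame_matrix (M *m N) = frame_matrix M *m frame_matrix N.
Proof.
apply/matrixP => i j; rewrite !mxE -mulmxA mulmx_frame_expand ip_sumr.
rewrite (reindex_onto (@enum_val J xpredT) enum_rank)/=; last first.
  by move=> k _; rewrite enum_rankK.
apply: eq_big => [k|k _]; first by rewrite enum_valK eqxx.
by rewrite ipZr !mxE mulrC.
Qed.

Lemma frame_matrix_inj : injective frame_matrix.
Proof.
move=> M N MN; apply: eq_mulmx_col => x; rewrite !mulmx_frame_expand.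
apply: eq_bigr => j _; congr (_ *: _).
rewrite [LHS](col_frame_expand frm) [RHS](col_frame_expand frm).
apply: eq_bigr => k _; congr (_%:A *: _).
by have /matrixP/(_ (enum_rank k) (enum_rank j)) := MN; rewrite !mxE !enum_rankK.
Qed.

(** As [K] need not be commutative, determinants have to be taken over the reals.
    Writing matrices over [K] in the frame is an injective multiplicative map into
    real matrices, sending [1] to an idempotent [p] (the projection onto the image
    of the analysis operator). If [M N = 1], the complement [1 - p] completes the
    images of [M] and [N] to mutually inverse real matrices. *)
Lemma mulmx1C_star M N : M *m N = 1%:M -> N *m M = 1%:M.
Proof.
move=> MN1; pose p := frame_matrix 1%:M.
pose a := frame_matrix M; pose c := frame_matrix N.
have ap : a *m p = a by rewrite -frame_matrixM mulmx1.
have pa : p *m a = a by rewrite -frame_matrixM mul1mx.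
have cp : c *m p = c by rewrite -frame_matrixM mulmx1.
have pc : p *m c = c by rewrite -frame_matrixM mul1mx.
have pp : p *m p = p by rewrite -frame_matrixM mulmx1.
have ac : a *m c = p by rewrite -frame_matrixM MN1.
have complete (s t : 'M[R]_(#|{: J}|)) : s *m p = s -> p *m t = t ->
    (s + (1%:M - p)) *m (t + (1%:M - p)) = s *m t + (1%:M - p).
  move=> sp pt; have q0 : s *m (1%:M - p) = 0 by rewrite mulmxBr mulmx1 sp subrr.
  have p0 : (1%:M - p) *m p = 0 by rewrite mulmxBl mul1mx pp subrr.
  have qq : (1%:M - p) *m (1%:M - p) = 1%:M - p by rewrite mulmxBr p0 subr0 mulmx1.
  have qt : (1%:M - p) *m t = 0 by rewrite -pt mulmxA p0 mul0mx.
  move: (1%:M - p) q0 qq qt => q q0 qq qt.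
  by rewrite mulmxDl !mulmxDr q0 qq qt addr0 add0r.
have : (a + (1%:M - p)) *m (c + (1%:M - p)) = 1%:M.
  by rewrite complete// ac addrC subrK.
move/mulmx1C; rewrite complete// => ca.
apply: frame_matrix_inj; rewrite frame_matrixM -/p.
by apply/eqP; rewrite -(inj_eq (addIr (1%:M - p))) ca addrC subrK.
Qed.

(** [k = M N^-1] preserves the real part of the hermitian product; testing it
    against the entries of [k^* k - 1] shows that these vanish. *)
Lemma unitary_of_isometric M N :
  invertible_mx N ->
  (forall x y, ip (M *m x) (M *m y) = ip (N *m x) (N *m y)) ->
  exists2 k, unitary k & M = k *m N.
Proof.
move=> [N' [NN' N'N]] MN; exists (M *m N'); last first.
  by rewrite -mulmxA N'N mulmx1.
set k := M *m N'.
have kP x y : ip (k *m x) (k *m y) = ip x y.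
  by rewrite /k -!mulmxA MN !mulmxA NN' !mul1mx.
suff k1 : adjmx k *m k = 1%:M.
  by rewrite -[k]adjmxK; apply: unitaryV; rewrite /unitary adjmxK.
have ipE x y : ip x y = sre ((adjmx x *m y) 0 0) by rewrite /ip hermitian_productE.
have k0 (x y : 'cV[K]_m) : sre ((adjmx x *m (adjmx k *m k - 1%:M) *m y) 0 0) = 0.
  have := kP x y; rewrite !ipE adjmxM => H.
  have sreB (u v : K) : sre (u - v) = sre u - sre v.
    by rewrite -scaleN1r sreD sreZ mulN1r.
  have mxB (A B : 'M[K]_1) : (A - B) 0 0 = A 0 0 - B 0 0 by rewrite !mxE.
  rewrite mulmxBr mulmxBl mulmx1 mxB sreB; apply/eqP; rewrite subr_eq0; apply/eqP.
  by rewrite -H !mulmxA.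
apply/eqP; rewrite -subr_eq0; apply/eqP; move: (adjmx k *m k - 1%:M) k0 => Z k0.
apply/matrixP => i j; rewrite [RHS]mxE; apply: (@sre_eq0 R).
have := k0 (\col_l if l == i then Z i j else 0) (delta_mx j 0).
rewrite -mulmxA -colE mxE (bigD1 i)//= !mxE eqxx big1 ?addr0// => l li.
by rewrite !mxE (negPf li) sconj0 mul0r.
Qed.

End Inverse.

Section MarkedMatrix.
Context {R : realType} {K : starAlgType R} (frm : parseval_frame K).
Context (O : subringClosed K) (m : nat).
Local Notation Om := ('cV[order_ring O]_m).
Local Notation Km := ('cV[K]_m).

Lemma oval0 : oval (0 : order_ring O) = 0.
Proof. exact: (raddf0 (val : order_ring O -> K)). Qed.

Lemma ovalD (x y : order_ring O) : oval (x + y) = oval x + oval y.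
Proof. exact: (raddfD (val : order_ring O -> K)). Qed.

Lemma oval1 : oval (1 : order_ring O) = 1.
Proof. exact: (rmorph1 (val : order_ring O -> K)). Qed.

Lemma OinclD (u v : Om) : Oincl (u + v) = Oincl u + Oincl v.
Proof. by apply/colP => i; rewrite !mxE ovalD. Qed.

Lemma Oincl_delta j : Oincl (delta_mx j 0 : Om) = delta_mx j 0.
Proof. by apply/colP => i; rewrite !mxE; case: (_ && _); rewrite ?oval1 ?oval0. Qed.

Lemma is_basis_rinv (b : 'M[K]_m) : is_basis b -> exists b', b *m b' = 1%:M.
Proof.
move=> bb; have /choice[c Hc] : forall j : 'I_m, exists c : Km,
    delta_mx j 0 = b *m c by move=> j; have [c [-> _]] := bb (delta_mx j 0); exists c.
exists (\matrix_(i, j) c j i 0); apply/matrixP => i j.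
have /colP/(_ i) := Hc j; rewrite !mxE andbT => ->.
by apply: eq_bigr => k _; rewrite !mxE.
Qed.

(** A marked lattice extends to an invertible endomorphism of [K^m]: its range
    contains a [K]-basis, so its matrix has a right inverse. *)
Lemma marked_lattice_matrix (f : Om -> Km) : is_marked_lattice f ->
  exists2 M, invertible_mx M & forall u, f u = M *m Oincl u.
Proof.
move=> [fD fZ [b bb fb]].
have f0 : f 0 = 0 by apply: (@addrI _ (f 0)); rewrite -fD !addr0.
pose M : 'M[K]_m := \matrix_(i, j) f (delta_mx j 0) i 0.
have fE u : f u = M *m Oincl u.
  rewrite mulmx_sum_rscale.
  have {1}-> : u = \sum_j rscale (delta_mx j 0) (u j 0).
    rewrite -[LHS]mul1mx; apply/colP => i; rewrite mxE summxE.
    by apply: eq_bigr => j _; rewrite !mxE eqxx andbT.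
  rewrite (big_morph f fD f0); apply: eq_bigr => j _; rewrite fZ [in RHS]mxE.
  by congr rscale; apply/colP => i; rewrite !mxE.
exists M => //.
have [b' bb'] := is_basis_rinv bb.
have /choice[u Hu] : forall j : 'I_m, exists u : Om, col j b = M *m Oincl u.
  move=> j; have [u _ uE] : range f (col j b).
    by rewrite fb; exists (delta_mx j 0) => //; rewrite Oincl_delta -colE.
  by exists u; rewrite -fE uE.
have MU : M *m (\matrix_(i, j) oval (u j i 0)) = b.
  apply/matrixP => i j; have /colP/(_ i) := Hu j; rewrite !mxE => ->.
  by apply: eq_bigr => k _; rewrite !mxE.
have MV : M *m ((\matrix_(i, j) oval (u j i 0)) *m b') = 1%:M by rewrite mulmxA MU.
by eexists; split; [exact: MV | exact: (mulmx1C_star frm)].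
Qed.

End MarkedMatrix.

(** * Finite families of measurable sets *)

Section FiniteFamilies.
Context d (X : measurableType d) (R : realType) (mu : {measure set X -> \bar R}).
Context (T : eqType).

Lemma sum_measure_disjoint (A : T -> set X) (B : set X) (s : seq T) :
  (forall u, measurable (A u)) -> measurable B -> uniq s ->
  (forall u, u \in s -> A u `<=` B) ->
  (forall u v x, A u x -> A v x -> u = v) ->
  (\sum_(u <- s) mu (A u) <= mu B)%E.
Proof.
move=> mA + + + dA; elim: s B => [|u s IH] B mB; first by rewrite big_nil.
move=> /= /andP[us s_uniq] AB; rewrite big_cons (measureDI mu mB (mA u)) addeC.
apply: leeD.
  apply: IH => //; first exact: measurableD.
  move=> v vs x Avx; split; first by apply: AB Avx; rewrite inE vs orbT.
  by move=> Aux; move: us; rewrite (dA _ _ _ Aux Avx) vs.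
rewrite setIC; have -> // : A u `&` B = A u.
by apply/setIidl/AB; rewrite inE eqxx.
Qed.

(** Integrate the number of sets of the family that contain a point. *)
Lemma sum_measure_multiplicity (A : T -> set X) (F : set X) (c : R) (s : seq T) :
  (forall u, measurable (A u)) -> measurable F ->
  (forall x, F x -> (\sum_(u <- s) \1_(A u) x <= c :> R)%R) ->
  (\sum_(u <- s) mu (A u `&` F) <= c%:E * mu F)%E.
Proof.
move=> mA mF Ac.
under eq_bigr do rewrite -(integral_indic mu mF (mA _)).
rewrite -ge0_integral_sum//; first last.
- by move=> u; apply/measurable_EFinP; exact: measurable_indic.
rewrite -integral_cst//; apply: ge0_le_integral => //.
- by move=> x _; apply: sume_ge0 => u _; rewrite lee_fin.
- by apply: emeasurable_sum => u; apply/measurable_EFinP; exact: measurable_indic.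
- by move=> x Fx; rewrite sumEFin lee_fin; exact: Ac.
Qed.

Lemma measure_le_sum_cover (A : T -> set X) (B : set X) (s : seq T) :
  (forall u, measurable (A u)) -> measurable B ->
  (forall x, B x -> exists2 u, u \in s & A u x) ->
  (mu B <= \sum_(u <- s) mu (A u))%E.
Proof.
move=> mA; elim: s B => [|u s IH] B mB cov.
  rewrite big_nil (_ : B = set0) ?measure0//.
  by apply/seteqP; split=> x // /cov[].
rewrite big_cons (measureDI mu mB (mA u)) addeC; apply: leeD.
  by apply: le_measure; rewrite ?inE; [exact: measurableI | exact: mA | exact: subIsetr].
apply: IH; first exact: measurableD.
by move=> x [/cov[v + Avx]] nAux; rewrite inE => /predU1P[vu|]; [rewrite vu in Avx | exists v].
Qed.

End FiniteFamilies.

(** * Counting lattice points in balls *)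

Section Haar.
Context {R : realType} {K : starAlgType R} (frm : parseval_frame K) (m : nat).
Local Notation Km := ('cV[K]_m).
Context (mu : {measure set (borel_Km K m) -> \bar R}) (haar : is_haar mu).

Definition vball (x : Km) (r : R) : set (borel_Km K m) :=
  [set y : Km | vnorm (y - x) < r].

Lemma open_borel (A : set Km) : open A -> measurable (A : set (borel_Km K m)).
Proof. by move=> oA; apply: sub_sigma_algebra. Qed.

Lemma vball_measurable (x : Km) (r : R) : measurable (vball x r).
Proof. by apply: open_borel; exact: (open_vball frm). Qed.

Definition translate (l : Km) (A : set (borel_Km K m)) : set (borel_Km K m) :=
  [set x : Km | A (x + l)].

Lemma translate_measurable (l : Km) (A : set (borel_Km K m)) :
  measurable A -> measurable (translate l A).
Proof.
move=> mA; rewrite -[translate _ _]setTI.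
apply: (measurability (f := fun x : borel_Km K m => (x : Km) + l : borel_Km K m)
  (@open Km : set (set (borel_Km K m)))) => // _ [B oB <-].
rewrite setTI; apply: open_borel; apply/(open_vnormP frm) => x /= Bx.
have [e e0 eB] := (open_vnormP frm _).1 oB _ Bx.
exists e => // y yx; apply: eB; rewrite opprD addrACA subrr addr0//.
Qed.

Lemma translate_measure (l : Km) (A : set (borel_Km K m)) :
  measurable A -> mu (translate l A) = mu A.
Proof.
move=> mA; have [tr _ _] := haar; rewrite -(tr (- l) A mA); congr (mu _).
apply/seteqP; split=> [x Ax|_ [y Ay <-]].
  by exists ((x : Km) + l) => //; rewrite addrC addrK.
by rewrite /translate /= addrC addrA subrr add0r.
Qed.

Lemma vball_finite (x : Km) (r : R) : (mu (vball x r) < +oo)%E.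
Proof.
have [_ fin _] := haar.
pose B : set (borel_Km K m) := [set y : Km | vnorm y <= r + vnorm x].
apply: (@le_lt_trans _ _ (mu B)); first last.
  exact/fin/(closed_vball_compact frm).
have mC : measurable B.
  rewrite -[X in measurable X]setCK; apply: measurableC; apply: open_borel.
  by rewrite openC; apply: (closed_vball_closed frm).
apply: le_measure; rewrite ?inE//; first exact: vball_measurable.
move=> y; rewrite /vball /B /= => yx.
have := vnormD frm (y - x : Km) x; rewrite subrK; lra.
Qed.

(** The ball is centred at 0; by translation invariance the centre is irrelevant,
    see [ball_volumeE]. *)
Definition ball_volume (r : R) : R := fine (mu (vball 0 r)).

Lemma ball_volumeE (x : Km) r : mu (vball x r) = (ball_volume r)%:E.
Proof.
rewrite /ball_volume fineK ?ge0_fin_numE ?vball_finite//.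
rewrite -(@translate_measure x (vball x r)); last exact: vball_measurable.
by congr (mu _); apply/seteqP; split=> y; rewrite /translate/vball/= addrK subr0.
Qed.

Lemma ball_volume_gt0 r : 0 < r -> 0 < ball_volume r.
Proof.
move=> r0; have [_ _ pos] := haar; rewrite -lte_fin -(ball_volumeE 0).
apply: pos; first exact: (open_vball frm).
by exists 0; rewrite /vball /= subr0 vnorm0.
Qed.

Lemma le_ball_volume r s : r <= s -> ball_volume r <= ball_volume s.
Proof.
move=> rs; rewrite -lee_fin -!(ball_volumeE 0).
apply: le_measure; rewrite ?inE; try exact: vball_measurable.
by move=> y; rewrite /vball/= => /lt_le_trans; apply.
Qed.

(** The ball of radius [3 r] contains two disjoint balls of radius [r], around 0
    and around a vector of norm [2 r]. *)
Lemma ball_volume_triple r : (0 < m)%N -> 0 < r ->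
  2 * ball_volume r <= ball_volume (3 * r).
Proof.
move=> m0 r0.
have [p pr] : exists p : Km, vnorm p = 2 * r.
  pose w : Km := const_mx 1.
  have w0 : 0 < vnorm w.
    apply: (vnorm_gt0); apply/eqP => /matrixP/(_ (Ordinal m0) 0)/eqP.
    by rewrite !mxE oner_eq0.
  exists ((2 * r / vnorm w)%:A *: w); rewrite (vnormZ frm).
  by rewrite ger0_norm ?divfK ?gt_eqF// divr_ge0 ?vnorm_ge0// mulr_ge0// ltW.
pose c (b : bool) : Km := if b then p else 0.
suff : (\sum_(b <- [:: true; false]) mu (vball (c b) r) <= mu (vball 0 (3 * r)))%E.
  rewrite !big_cons big_nil !ball_volumeE adde0 -EFinD lee_fin; lra.
apply: sum_measure_disjoint => //.
- by move=> b; exact: vball_measurable.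
- exact: vball_measurable.
- move=> b _ x; rewrite /vball/= subr0 => xc.
  have : vnorm (c b) <= 2 * r.
    by case: b {xc}; rewrite /c ?pr// vnorm0 mulr_ge0// ltW.
  have := vnormD frm (x - c b : Km) (c b); rewrite subrK; lra.
- have dis (x : Km) : vball p r x -> vball 0 r x -> False.
    rewrite /vball/= subr0 => xp xr.
    have := vnormB_le frm p x 0; rewrite !subr0 pr (vnorm_distC frm p); lra.
  by move=> [] [] x; rewrite /c//= => h1 h2; exfalso; apply: (dis x).
Qed.

Section Counting.
Variables (T : eqType) (f : T -> Km) (F : set (borel_Km K m)).
Hypotheses (f_inj : injective f) (Fdom : fundamental_domain (range f) F).

Lemma fundamental_domain_uniq (x : Km) u v : F (x + f u) -> F (x + f v) -> u = v.
Proof.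
move=> Fu Fv; have [_ /(_ x)[l [_ lU]]] := Fdom; apply: f_inj.
rewrite -(lU (f u)); last by split=> //; exists u.
by apply: lU; split=> //; exists v.
Qed.

(** Translates of the part of [F] in a ball of radius [D] are disjoint and stay
    within [D] of the lattice points. The part of [F] outside this ball has small
    measure for large [D], as [exists_bounded_part] shows. *)
Lemma packing_bound (D r : R) (s : seq T) : uniq s ->
  (forall u, u \in s -> vnorm (f u) < r) ->
  ((size s)%:R%:E * mu (F `&` vball 0 D) <= (ball_volume (r + D))%:E)%E.
Proof.
move=> su sr; have [mF _] := Fdom.
have mFD : measurable (F `&` vball 0 D).
  by apply: measurableI => //; exact: vball_measurable.
pose A u := translate (f u) (F `&` vball 0 D).
have -> : ((size s)%:R%:E * mu (F `&` vball 0 D) = \sum_(u <- s) mu (A u))%E.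
  rewrite (eq_bigr (fun=> mu (F `&` vball 0 D))); last first.
    by move=> u _; rewrite translate_measure.
  by rewrite big_const_seq count_predT iter_addr addr0 mule_natl.
rewrite -(ball_volumeE 0); apply: sum_measure_disjoint => //.
- by move=> u; exact: translate_measurable.
- exact: vball_measurable.
- move=> u us x [_]; rewrite /vball /= !subr0 => xD.
  have := vnormD frm ((x : Km) + f u) (- f u).
  rewrite addrK (vnormN frm); have := sr u us; lra.
- by move=> u v x [Fu _] [Fv _]; exact: fundamental_domain_uniq Fu Fv.
Qed.

(** [B_r] is the union of its intersections with the translates [F - f u];
    moved back into [F], these pieces cover each point [y] as often as [f] hits
    the ball of radius [r] around [y]. *)
Lemma covering_bound (h : T -> nat) (c r : R) : injective h ->
  (forall (y : Km) (s : seq T), uniq s ->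
    (count (fun u => vnorm (y - f u) < r) s)%:R <= c) ->
  ((ball_volume r)%:E <= c%:E * mu F)%E.
Proof.
move=> h_inj hc; have [mF cov] := Fdom.
pose piece u := vball 0 r `&` translate (f u) F.
have mpiece u : measurable (piece u).
  by apply: measurableI; [exact: vball_measurable | exact: translate_measurable].
have piece_measure u : mu (piece u) = mu (vball (f u) r `&` F).
  rewrite -(@translate_measure (f u) (_ `&` F)); last first.
    by apply: measurableI => //; exact: vball_measurable.
  by congr (mu _); apply/seteqP; split=> x; rewrite /piece/translate/vball/= addrK subr0.
have /choice[k kP] : forall n, exists o : option T,
    if o is Some u then h u = n else forall u, h u <> n.
  move=> n; have [[u hu]|H] := pselect (exists u, h u = n); first by exists (Some u).
  by exists None => u hu; apply: H; exists u.
pose A n := if k n is Some u then piece u else set0.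
have mA n : measurable (A n) by rewrite /A; case: (k n).
have kh u : k (h u) = Some u.
  by have := kP (h u); case: (k _) => [v /h_inj->//|/(_ u)].
rewrite -(ball_volumeE 0).
have sub : vball 0 r `<=` \bigcup_n A n.
  move=> x xr; have [l [[[u _ <-] Fx] _]] := cov x.
  by exists (h u) => //; rewrite /A kh.
apply: le_trans (measure_sigma_subadditive mu mA (vball_measurable 0 r) sub) _.
apply: lime_le; first by apply: is_cvg_nneseries => n _ _.
apply: nearW => N; pose s := pmap k (iota 0 N).
have -> : (\sum_(0 <= n < N) mu (A n) = \sum_(u <- s) mu (vball (f u) r `&` F))%E.
  rewrite /s /index_iota subn0; elim: (iota 0 N) => [|n t IH]; first by rewrite !big_nil.
  rewrite big_cons IH /= /A; case: (k n) => [u|] /=; last by rewrite measure0 add0e.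
  by rewrite big_cons piece_measure.
have s_uniq : uniq s.
  apply: (@pmap_uniq _ _ k (fun u => h u)) (iota_uniq 0 N).
  by move=> n; have := kP n; case: (k n) => //= u ->.
apply: sum_measure_multiplicity => // [u|y _]; first exact: vball_measurable.
apply: le_trans (hc y s s_uniq); rewrite -sum1_count natr_sum big_mkcond.
rewrite [leRHS]big_mkcond; apply: ler_sum => u _ /=.
rewrite indicE; case: ifPn => yu; first by case: (_ \in _).
by rewrite (_ : _ \in _ = false)//; apply: negbTE; apply: contra yu => /set_mem.
Qed.

End Counting.
End Haar.

(** * Comparison of covolumes *)

Lemma bernoulli_inequality (R : realDomainType) (x : R) n :
  -1 <= x -> 1 + x *+ n <= (1 + x) ^+ n.
Proof.
move=> x1; have x1' : 0 <= 1 + x by rewrite -lerBlDl sub0r.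
elim: n => [|n IH]; first by rewrite mulr0n addr0 expr0.
rewrite exprS; apply: le_trans (ler_wpM2l x1' IH).
rewrite -subr_ge0 (_ : _ - _ = x ^+ 2 *+ n); last by ring.
by rewrite mulrn_wge0// sqr_ge0.
Qed.

Lemma exists_expr_le (R : archiRealFieldType) (c e : R) : 0 < c < 1 -> 0 < e ->
  exists j, c ^+ j <= e.
Proof.
move=> /andP[c0 c1] e0; pose x := c^-1 - 1.
have x0 : 0 < x by rewrite subr_gt0 invf_gt1.
exists (Num.bound (e^-1 / x)); set j := Num.bound _.
have jx : e^-1 < x *+ j.
  rewrite -mulr_natl -ltr_pdivrMr// archi_boundP// divr_ge0 ?invr_ge0 ?ltW//.
have : e^-1 <= (c^-1) ^+ j.
  rewrite (_ : c^-1 = 1 + x); last by rewrite addrC subrK.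
  apply: le_trans (bernoulli_inequality j _); last by apply: le_trans (ltW x0); rewrite lerN10.
  by apply: le_trans (ltW jx) _; rewrite lerDr.
by rewrite exprVn lef_pV2// posrE// exprn_gt0.
Qed.

(** Iterating the hypothesis brings the radius [r] down to at most [r / 3] in a number of
    steps that depends on [c] only, while losing an arbitrarily small part of
    the volume; but a third of the radius costs half of the volume. *)
Lemma no_almost_invariant_contraction (R : realType) (v : R -> R) (c : R) :
  0 < c < 1 ->
  (forall r, 0 < r -> 0 < v r) ->
  (forall r s, r <= s -> v r <= v s) ->
  (forall r, 0 < r -> 2 * v r <= v (3 * r)) ->
  (forall d, 0 < d < 1 -> exists2 D, 0 <= D &
     forall r, 0 < r -> (1 - d) * v r <= v (c * r + D)) -> False.
Proof.
move=> /andP[c0 c1] v_gt0 v_mono v_triple v_contr.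
(* For large [r], the bounded term [D] is absorbed by [c' r - c r]. *)
pose c' := (1 + c) / 2.
have cc' : c < c' by rewrite /c'; lra.
have c'0 : 0 < c' by exact: lt_trans cc'.
have c'1 : c' < 1 by rewrite /c'; lra.
have [j cj] : exists j, c' ^+ j <= 3^-1.
  by apply: exists_expr_le; rewrite ?c'0.
(* The [j] steps together lose at most a quarter, by Bernoulli's inequality. *)
pose d : R := (4 * j.+1%:R)^-1.
have d0 : 0 < d by rewrite invr_gt0 mulr_gt0.
have dj : d *+ j <= 4^-1.
  rewrite -[d *+ j]mulr_natl /d invfM mulrCA ler_piMr// ler_pdivrMr// mul1r ler_nat//.
have d1 : d < 1.
  by rewrite invf_lt1// (@lt_le_trans _ _ 4) ?ltr1n// ler_peMr// ler1n.
have [|D D0 Dv] := v_contr d; first by rewrite d0.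
have c'j (i : nat) : 0 < c' ^+ i by rewrite exprn_gt0.
pose r0 := D / (c' - c) + 1.
have r00 : 0 < r0 by rewrite ltr_wpDl// divr_ge0// subr_ge0 ltW.
(* All radii met in [j] contractions of [rho] by [c'] are at least [r0]. *)
pose rho := r0 / c' ^+ j.
have rho0 : 0 < rho by rewrite divr_gt0.
have iter i : (i <= j)%N -> (1 - d) ^+ i * v rho <= v (c' ^+ i * rho).
  elim: i => [|i IH] ij; first by rewrite !expr0 !mul1r.
  rewrite exprS -mulrA; apply: (@le_trans _ _ ((1 - d) * v (c' ^+ i * rho))).
    by rewrite ler_wpM2l ?subr_ge0 ?(ltW d1)//; exact: IH (ltnW ij).
  apply: le_trans (Dv _ _) _; first by rewrite mulr_gt0.
  apply: v_mono; rewrite exprS -mulrA -lerBrDl -mulrBl.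
  have : D / (c' - c) <= c' ^+ i * rho.
    apply: (@le_trans _ _ r0); first by rewrite lerDl.
    rewrite /rho mulrCA ler_peMr ?(ltW r00)//; rewrite ler_pdivlMr// mul1r.
    by rewrite ler_wiXn2l// ?ltW// ltnW.
  by rewrite ler_pdivrMr ?subr_gt0// mulrC.
have Hj := iter j (leqnn j).
have half : v (c' ^+ j * rho) <= v rho / 2.
  apply: (@le_trans _ _ (v (rho / 3))).
    by apply: v_mono; rewrite mulrC ler_wpM2l// ltW.
  rewrite ler_pdivlMr// mulrC; apply: le_trans (v_triple _ _) _.
    by rewrite divr_gt0.
  by rewrite mulrC divfK.
have bern : 1 - 4^-1 <= (1 - d) ^+ j.
  apply: le_trans (bernoulli_inequality j _); last by rewrite lerN2 ltW.
  by rewrite mulNrn lerD2l lerN2.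
have := v_gt0 _ rho0 => vrho.
have : (1 - 4^-1) * v rho <= v rho / 2.
  apply: le_trans half; apply: le_trans Hj; apply: ler_wpM2r => //; exact: ltW.
by move=> H; lra.
Qed.

(** Many steps of length [D] fit between [r] and [2 r]; each multiplies [v] by
    [b / a], while [v (2 r)] is a bounded multiple of [v r]. *)
Lemma no_geometric_growth (R : realType) (v : R -> R) (a b C D : R) :
  (forall r, 0 < r -> 0 < v r) ->
  (forall r s, r <= s -> v r <= v s) ->
  (forall r, 0 < r -> v (2 * r) <= C * v r) ->
  0 <= a -> 0 <= D ->
  (forall r, 0 < r -> b * v r <= a * v (r + D)) -> b <= a.
Proof.
move=> v_gt0 v_mono v_double a0 D0 growth; rewrite leNgt; apply/negP => ab.
have b0 : 0 < b by exact: le_lt_trans ab.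
have {}a0 : 0 < a.
  rewrite lt_neqAle a0 andbT; apply/eqP => a0'.
  have := growth 1 ltr01; rewrite -a0' mul0r leNgt mulr_gt0//.
  exact: v_gt0.
have C0 : 0 < C.
  have := v_double 1 ltr01 => H.
  have := lt_le_trans (v_gt0 _ (mulr_gt0 (ltr0Sn R 1) ltr01)) H.
  by rewrite pmulr_lgt0// v_gt0.
(* [N] steps multiply [v] by at least [2 C]. *)
have [N HN] : exists N, (a / b) ^+ N <= (2 * C)^-1.
  by apply: exists_expr_le; rewrite ?divr_gt0 ?ltr_pdivrMr ?mul1r ?invr_gt0 ?mulr_gt0.
have steps n r : 0 < r -> v r <= (a / b) ^+ n * v (r + D *+ n).
  move=> r0; elim: n => [|n IH]; first by rewrite expr0 mul1r mulr0n addr0.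
  apply: le_trans IH _; rewrite exprSr -mulrA ler_pM2l ?exprn_gt0 ?divr_gt0//.
  rewrite mulrAC ler_pdivlMr// mulrC; apply: le_trans (growth _ _) _.
    by rewrite ltr_pwDl// mulrn_wge0.
  by rewrite mulrSr addrA.
pose r := D *+ N + 1.
have r0 : 0 < r by rewrite ltr_wpDl// mulrn_wge0.
have := steps N r r0; rewrite leNgt => /negP; apply.
apply: (@le_lt_trans _ _ ((2 * C)^-1 * (C * v r))); last first.
  rewrite invfM -mulrA mulKf ?gt_eqF//; have := v_gt0 r r0; lra.
apply: ler_pM => //; first by rewrite exprn_ge0// divr_ge0// ltW.
  by rewrite ltW// v_gt0// ltr_wpDr// mulrn_wge0.
apply: le_trans (v_double _ r0); apply: v_mono; rewrite /r; lra.
Qed.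

Section Comparison.
Context {R : realType} {K : starAlgType R} (frm : parseval_frame K) (m : nat).
Local Notation Km := ('cV[K]_m).
Context (mu : {measure set (borel_Km K m) -> \bar R}) (haar : is_haar mu).
Local Notation v := (ball_volume mu).

(* The characterization of compactness by open covers is stated for pointed
   spaces. *)
HB.instance Definition _ := Topological.copy (@pointed_Km R K m) Km.

(** Scale a finite cover of the compact ball of radius 2 by unit balls. *)
Lemma ball_volume_double : exists C, forall r, 0 < r -> v (2 * r) <= C * v r.
Proof.
have : @compact (@pointed_Km R K m) [set y : Km | vnorm y <= 2 :> R].
  exact: (closed_vball_compact frm).
rewrite compact_cover => /(_ Km setT (fun p => [set y | vnorm (y - p) < 1])) [].
- by move=> p _; exact: (open_vball frm).
- by move=> x _; exists x => //=; rewrite subrr vnorm0.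
move=> Pset _ cover; pose P : seq Km := finmap.enum_fset Pset.
exists (size P)%:R => r r0.
have : (mu (vball 0 (2 * r)) <= \sum_(p <- P) mu (vball (r%:A *: p) r))%E.
  apply: measure_le_sum_cover.
  - by move=> p; exact: (vball_measurable frm).
  - exact: (vball_measurable frm).
  move=> x; rewrite /vball/= subr0 => xr.
  have rx (y : Km) : r%:A *: (r^-1%:A *: y) = y.
    by rewrite scalerA mulr_algl scalerA divff ?gt_eqF// !scale1r.
  have [p Pp xp] : (\bigcup_(p in [set p | p \in P])
      [set y : Km | vnorm (y - p) < 1]) (r^-1%:A *: x).
    apply: cover; rewrite /= (vnormZ frm) gtr0_norm ?invr_gt0// mulrC.
    by rewrite ler_pdivrMr// ltW.
  exists p => //=; rewrite -[x]rx -scalerBr (vnormZ frm) gtr0_norm//.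
  by rewrite gtr_pMr.
rewrite (ball_volumeE frm haar) (eq_bigr (fun=> (v r)%:E)); last first.
  by move=> p _; exact: (ball_volumeE frm haar).
rewrite sumEFin lee_fin big_const_seq count_predT iter_addr addr0 => H.
by rewrite [leRHS]mulr_natl.
Qed.

Lemma exists_bounded_part (F : set (borel_Km K m)) (b : R) :
  measurable F -> (b%:E < mu F)%E ->
  exists2 D : R, 0 <= D & (b%:E <= mu (F `&` vball 0 D))%E.
Proof.
move=> mF bF; apply: contrapT => H.
have mG (n : nat) : measurable (F `&` vball 0 n%:R).
  by apply: measurableI => //; exact: (vball_measurable frm).
have FE : \bigcup_n (F `&` vball 0 n%:R) = F.
  apply/seteqP; split=> [x [n _ []]//|x Fx].
  exists (Num.bound (vnorm (x - 0 : Km))) => //; split=> //.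
  by rewrite /vball/= archi_boundP// vnorm_ge0.
have := @nondecreasing_cvg_mu _ _ _ mu _ mG; rewrite FE => /(_ mF) cv.
have {}cv : (mu (F `&` vball 0 n%:R)) @[n --> \oo] --> mu F.
  apply: cv => n p np; apply/subsetPset => x [Fx xn]; split=> //.
  by move: xn; rewrite /vball/= => /lt_le_trans; apply; rewrite ler_nat.
have : (lim ((mu (F `&` vball 0 n%:R)) @[n --> \oo]) <= b%:E)%E.
  apply: lime_le; first by apply/cvg_ex; eexists; exact: cv.
  apply: nearW => n; rewrite leNgt; apply/negP => /ltW ?; apply: H.
  by exists n%:R.
by rewrite (cvg_lim _ cv)// leNgt bF.
Qed.

Section TwoLattices.
Context (T : zmodType) (f g : T -> Km) (h : T -> nat).
Context (F G : set (borel_Km K m)).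
Hypotheses (h_inj : injective h) (fB : {morph f : u v / u - v}).
Hypotheses (g_inj : injective g) (Fdom : fundamental_domain (range f) F).
Hypotheses (Gdom : fundamental_domain (range g) G).
Hypothesis cocompact : exists D, forall x, exists u, vnorm (x - f u) <= D.

(** By [covering_bound], [f] has at least about [v r / mu F] values in [B_r]. The
    corresponding values of [g] lie in [B_(c r)], which by [packing_bound]
    contains at most about [v (c r) / mu G] of them. *)
Lemma counting_comparison (a b c : R) :
  mu F = a%:E -> 0 < b -> (b%:E < mu G)%E -> 0 <= c ->
  (forall u, vnorm (g u) <= c * vnorm (f u)) ->
  exists2 D, 0 <= D & forall r, 0 < r -> b * v r <= a * v (c * r + D).
Proof.
move=> Fa b0 bG c0 fg; have [D0 D0P] := cocompact.
have D00 : 0 <= D0 by have [u] := D0P 0; apply: le_trans; exact: vnorm_ge0.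
have [D1 D10 GD] := exists_bounded_part Gdom.1 bG.
exists (c * D0 + 1 + D1); first by rewrite addr_ge0// addr_ge0// mulr_ge0.
move=> r r0; set w := v (_ + _).
have : ((v r)%:E <= (w / b)%:E * mu F)%E.
  apply: (covering_bound frm haar Fdom h_inj) => y s s_uniq.
  have [u0 yu0] := D0P y.
  pose s' := [seq u - u0 | u <- s & vnorm (y - f u) < r].
  have s'_uniq : uniq s' by rewrite map_inj_uniq ?filter_uniq//; exact: addIr.
  have s'P x : x \in s' -> vnorm (g x) < c * (r + D0) + 1.
    move=> /mapP[u]; rewrite mem_filter => /andP[yu _] ->.
    apply: le_lt_trans (fg _) _; rewrite ltr_pwDr// ler_wpM2l//.
    rewrite fB; have := vnormB_le frm (f u) y (f u0).
    rewrite (vnorm_distC frm (f u) y); lra.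
  have := packing_bound frm haar g_inj Gdom D1 s'_uniq s'P.
  rewrite size_map size_filter => H.
  rewrite ler_pdivlMr// -lee_fin EFinM.
  apply: le_trans (lee_pmul _ _ (lexx _) GD) _; rewrite ?lee_fin ?(ltW b0)//.
  apply: le_trans H _; rewrite lee_fin.
  apply: (le_ball_volume frm haar); lra.
rewrite Fa lee_fin -(ler_pM2l b0) => H; apply: le_trans H _.
by rewrite mulrA [b * _]mulrC divfK ?gt_eqF// mulrC.
Qed.

(** With [c = 1] in [counting_comparison], [mu F < mu G] would make [v] grow by a
    fixed factor with every step of a fixed length. *)
Lemma covolume_le_of_norm_le (a : R) : mu F = a%:E ->
  (forall u, vnorm (g u) <= vnorm (f u)) -> (mu G <= a%:E)%E.
Proof.
move=> Fa fg; rewrite leNgt; apply/negP => aG.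
have a0 : 0 <= a by rewrite -lee_fin -Fa.
have [b ab bG] : exists2 b : R, a < b & (b%:E < mu G)%E.
  case E : (mu G) aG => [x| |]//; rewrite ?lte_fin => ax.
    by exists ((a + x) / 2); rewrite ?lte_fin; lra.
  by exists (a + 1); rewrite ?ltrDl// ltry.
have [|D D0 HD] := counting_comparison Fa (le_lt_trans a0 ab) bG ler01.
  by move=> u; rewrite mul1r.
have [C HC] := ball_volume_double.
suff : b <= a by rewrite leNgt ab.
apply: (no_geometric_growth _ _ HC a0 D0).
- by move=> r; exact: (ball_volume_gt0 frm haar).
- by move=> r s; exact: (le_ball_volume frm haar).
- by move=> r r0; rewrite -[X in X + D]mul1r HD.
Qed.

(** By [counting_comparison] a ball would keep almost all of its volume when its
    radius is multiplied by [c], which [no_almost_invariant_contraction] excludes. *)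
Lemma covolume_contraction (c : R) : (0 < m)%N ->
  mu F = 1%E -> mu G = 1%E ->
  (forall u, vnorm (g u) <= c * vnorm (f u)) -> 1 <= c.
Proof.
move=> m0 F1 G1 fg; rewrite leNgt; apply/negP => c1.
(* [c] itself might not be positive. *)
pose c' := Num.max c 2^-1.
have c'1 : 0 < c' < 1.
  by rewrite /c' lt_max invr_gt0 ltr0n orbT gt_max c1/= invf_lt1// ltr1n.
apply: (@no_almost_invariant_contraction R v c' c'1).
- by move=> r; exact: (ball_volume_gt0 frm haar).
- by move=> r s; exact: (le_ball_volume frm haar).
- by move=> r; exact: (ball_volume_triple frm haar).
move=> d /andP[d0 d1].
have [||||D D0 HD] := @counting_comparison 1 (1 - d) c' F1.
- by rewrite subr_gt0.
- by rewrite G1 lte_fin gtrBl.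
- by rewrite ltW//; case/andP: c'1.
- by move=> u; apply: le_trans (fg u) _; rewrite ler_wpM2r ?vnorm_ge0// le_max lexx.
by exists D => // r r0; rewrite -[leRHS]mul1r HD.
Qed.

End TwoLattices.

End Comparison.

(** * Norms and Gram forms of marked lattices *)

Section MarkedLattices.
Context {R : realType} {K : starAlgType R} (frm : parseval_frame K).
Context (O : subringClosed K) (m : nat).
Local Notation Om := ('cV[order_ring O]_m).
Local Notation Km := ('cV[K]_m).
Context (n : nat) (w : 'I_n -> Om).
Hypothesis w_span : forall x : Km, exists c : 'I_n -> R,
  x = \sum_j (c j)%:A *: Oincl (w j).

Lemma marked_inj (f : Om -> Km) : is_marked_lattice f -> injective f.
Proof.
move=> /(marked_lattice_matrix frm)[M [N [_ NM]] fE] u v.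
rewrite !fE => /(congr1 (mulmx N)); rewrite !mulmxA NM !mul1mx => /colP uv.
by apply/colP => i; apply: val_inj; have := uv i; rewrite !mxE.
Qed.

Lemma marked_sub (f : Om -> Km) : is_marked_lattice f ->
  {morph f : u v / u - v}.
Proof.
move=> [fD _ _] u v; apply: (@addIr _ (f v)).
by rewrite -fD !subrK.
Qed.

Lemma marked_int_comb (f : Om -> Km) (c : 'I_n -> int) : is_marked_lattice f ->
  f (\sum_j w j *~ c j) = \sum_j ((c j)%:~R : R)%:A *: f (w j).
Proof.
move=> fm; have fB := marked_sub fm; have [fD _ _] := fm.
have f0 : f 0 = 0 by rewrite -(subr0 0) fB subrr.
have fN u : f (- u) = - f u by rewrite -sub0r fB f0 sub0r.
have fnat u k : f (u *+ k) = f u *+ k.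
  by elim: k => [|k IH]; rewrite ?mulr0n// !mulrS fD IH.
have fint u k : f (u *~ k) = f u *~ k.
  by case: k => k; rewrite ?NegzE ?mulrNz -?pmulrn ?fN fnat.
rewrite (big_morph f fD f0); apply: eq_bigr => j _; rewrite fint.
by rewrite scaler_int scaler_int.
Qed.

(** Round the coordinates of [x] along the vectors [f (w j)] to integers. *)
Lemma marked_cocompact (f : Om -> Km) : is_marked_lattice f ->
  exists D : R, forall x : Km, exists u, vnorm (x - f u) <= D.
Proof.
move=> fm; exists (\sum_j vnorm (f (w j))) => x.
have [M [N [MN _]] fE] := marked_lattice_matrix frm fm.
have [c Nx] := w_span (N *m x).
have xE : x = \sum_j (c j)%:A *: f (w j).
  rewrite -[LHS]mul1mx -MN -mulmxA Nx mulmx_sumr.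
  by apply: eq_bigr => j _; rewrite scalar_mulmx fE.
exists (\sum_j w j *~ Num.floor (c j)); rewrite marked_int_comb// {1}xE -sumrB.
apply: le_trans (vnorm_sum frm _ _) _; apply: ler_sum => j _.
rewrite -scalerBl -scalerBl (vnormZ frm) ler_piMl ?vnorm_ge0//.
rewrite ger0_norm ?subr_ge0 ?floor_le// lerBlDr addrC ltW//.
by rewrite -intrD1 floorD1_gt.
Qed.

(** By polarization the norms of [M] and [N] on [O^m] determine their Gram forms
    on a spanning family, hence on [K^m]. *)
Lemma unitary_of_eq_vnorm (M N : 'M[K]_m) : invertible_mx N ->
  (forall u : Om, vnorm (M *m Oincl u) = vnorm (N *m Oincl u)) ->
  exists2 k, unitary k & M = k *m N.
Proof.
move=> N_inv MN; apply: (unitary_of_isometric N_inv).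
have H (u v : Om) : ip (M *m Oincl u) (M *m Oincl v) = ip (N *m Oincl u) (N *m Oincl v).
  by rewrite !(polarization frm) -!mulmxDr -OinclD !MN.
move=> x y; have [c ->] := w_span x; have [d ->] := w_span y.
rewrite !mulmx_sumr !(ip_suml frm); apply: eq_bigr => i _.
rewrite !scalar_mulmx !(ipZl frm); congr (_ * _).
by rewrite !ip_sumr; apply: eq_bigr => j _; rewrite !scalar_mulmx !ipZr H.
Qed.

(** Expand [x] in the frame first, where the coordinates are bounded by
    Cauchy-Schwarz, and then the finitely many frame vectors along the [w j]. *)
Lemma bounded_coords : exists2 C : R, 0 < C & forall x : Km,
  exists c : 'I_n -> R, x = \sum_j (c j)%:A *: Oincl (w j) /\
    \sum_j `|c j| <= C * vnorm x.
Proof.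
pose b := @col_frame R K frm m.
have /choice[a Ha] := fun j => w_span (b j).
pose C := \sum_j \sum_i (vnorm (b i) * `|a i j|).
have C0 : 0 <= C by apply: sumr_ge0 => j _; apply: sumr_ge0 => i _; rewrite mulr_ge0 ?vnorm_ge0.
exists (C + 1); first by rewrite ltr_wpDl.
move=> x; exists (fun j => \sum_i ip (b i) x * a i j); split.
  rewrite {1}[x](col_frame_expand frm).
  under eq_bigr do rewrite -/b Ha scaler_sumr.
  rewrite exchange_big; apply: eq_bigr => j _ /=.
  rewrite !scaler_suml; apply: eq_bigr => i _.
  by rewrite -Ha scalerA mulr_algl scalerA.
apply: (@le_trans _ _ (C * vnorm x)); last by rewrite ler_wpM2r ?vnorm_ge0// lerDl.
rewrite mulr_suml; apply: ler_sum => j _; rewrite mulr_suml.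
apply: le_trans (ler_norm_sum _ _ _) _; apply: ler_sum => i _.
rewrite normrM mulrAC ler_wpM2r//; exact: (cauchy_schwarz frm).
Qed.

Lemma sqr_vnorm_comb (c : 'I_n -> R) (x : 'I_n -> Km) :
  vnorm (\sum_j (c j)%:A *: x j) ^+ 2 = \sum_i \sum_j c i * c j * ip (x i) (x j).
Proof.
rewrite vnorm_sqr (ip_suml frm); apply: eq_bigr => i _.
by rewrite (ipZl frm) ip_sumr mulr_sumr; apply: eq_bigr => j _; rewrite ipZr mulrA.
Qed.

(** Polarization turns closeness of the norms on the [w i] and [w i + w j] into
    closeness of the Gram matrices, and a vector [x] has coordinates of size
    [O(|N x|)]. *)
Lemma sqr_vnorm_close (N : 'M[K]_m) (e : R) : invertible_mx N -> 0 < e ->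
  exists2 t : R, 0 < t & forall (M : 'M[K]_m) (l : R),
    (forall i j, `|l * vnorm (M *m Oincl (w i + w j)) ^+ 2
                 - vnorm (N *m Oincl (w i + w j)) ^+ 2| <= t) ->
    (forall i, `|l * vnorm (M *m Oincl (w i)) ^+ 2
                 - vnorm (N *m Oincl (w i)) ^+ 2| <= t) ->
    forall x, `|l * vnorm (M *m x) ^+ 2 - vnorm (N *m x) ^+ 2|
                <= e * vnorm (N *m x) ^+ 2.
Proof.
move=> [N' [_ N'N]] e0; have [C C0 HC] := bounded_coords.
have [C' C'0 HC'] := real_linear_bounded frm (mulmx_real_linear N').
pose t := e / (2 * (C * C') ^+ 2).
have t0 : 0 < t by rewrite divr_gt0// mulr_gt0// exprn_gt0// mulr_gt0.
exists t => // M l Hij Hi x.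
have [c [xE cx]] := HC x.
have {}cx : \sum_j `|c j| <= C * C' * vnorm (N *m x).
  apply: le_trans cx _; rewrite -mulrA ler_pM2l//.
  by rewrite -[X in vnorm X <= _](mul1mx) -N'N -mulmxA HC'.
have Gram i j : `|l * ip (M *m Oincl (w i)) (M *m Oincl (w j))
                 - ip (N *m Oincl (w i)) (N *m Oincl (w j))| <= 2 * t.
  rewrite !(polarization frm) -!mulmxDr -!OinclD.
  have := Hij i j; have := Hi i; have := Hi j; rewrite !ler_norml.
  move=> /andP[? ?] /andP[? ?] /andP[? ?]; apply/andP; split; lra.
have combE (A : 'M[K]_m) : vnorm (A *m x) ^+ 2 =
    \sum_i \sum_j c i * c j * ip (A *m Oincl (w i)) (A *m Oincl (w j)).
  by rewrite xE mulmx_sumr -sqr_vnorm_comb; under eq_bigr do rewrite scalar_mulmx.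
rewrite [in leLHS]combE [X in _ - X]combE mulr_sumr -sumrB.
apply: (@le_trans _ _ (\sum_i \sum_j `|c i| * `|c j| * (2 * t))).
  apply: le_trans (ler_norm_sum _ _ _) _; apply: ler_sum => i _.
  rewrite mulr_sumr -sumrB; apply: le_trans (ler_norm_sum _ _ _) _.
  apply: ler_sum => j _; rewrite mulrCA -mulrBr normrM normrM.
  by rewrite ler_wpM2l ?mulr_ge0.
have -> : \sum_i \sum_j `|c i| * `|c j| * (2 * t) = (\sum_i `|c i|) ^+ 2 * (2 * t).
  rewrite expr2 mulr_suml mulr_suml; apply: eq_bigr => i _.
  by rewrite mulr_sumr mulr_suml.
apply: (@le_trans _ _ ((C * C' * vnorm (N *m x)) ^+ 2 * (2 * t))).
  rewrite ler_wpM2r ?(mulr_ge0 _ (ltW t0))// ler_sqr// nnegrE ?sumr_ge0//.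
  by rewrite (le_trans _ cx)// sumr_ge0.
rewrite [X in X <= _](_ : _ = e * vnorm (N *m x) ^+ 2)//.
by rewrite /t; field; rewrite ?gt_eqF.
Qed.

End MarkedLattices.

(** * Markings of covolume 1 with close norms *)

Lemma norm_le_small_eq0 (R : realFieldType) (x C : R) :
  (forall e, 0 < e <= 1 -> `|x| <= e * C) -> x = 0.
Proof.
move=> H; apply/eqP; rewrite -normr_eq0 eq_le normr_ge0 andbT leNgt.
apply/negP => x0.
have C0 : 0 < C.
  by have := H 1; rewrite lexx ltr01 mul1r => /(_ isT); apply: lt_le_trans.
pose e := Num.min 1 (`|x| / (2 * C)).
have e0 : 0 < e by rewrite lt_min ltr01 divr_gt0// mulr_gt0.
have := H e; rewrite e0 ge_min lexx => /(_ isT); rewrite leNgt => /negP; apply.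
apply: (@le_lt_trans _ _ (`|x| / (2 * C) * C)).
  by rewrite ler_wpM2r ?(ltW C0)// ge_min lexx orbT.
by rewrite invfM mulrA divfK ?gt_eqF//; lra.
Qed.

Lemma dist_le_of_sqr (R : realFieldType) (q a e : R) : 0 <= q -> 0 <= a ->
  `|q ^+ 2 - a ^+ 2| <= e * a ^+ 2 -> `|q - a| <= e * a.
Proof.
move=> q0; rewrite le_eqVlt => /predU1P[<-|a0].
  rewrite expr0n /= !mulr0 !subr0 normr_le0 sqrf_eq0 => /eqP->.
  by rewrite normr0.
rewrite subr_sqr normrM => H; rewrite -(ler_pM2r a0) -mulrA -expr2.
apply: le_trans H; rewrite ler_wpM2l// ger0_norm ?lerDr//.
by rewrite addr_ge0// ltW.
Qed.

Section Markings.
Context {R : realType} {K : starAlgType R} (frm : parseval_frame K).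
Context (O : subringClosed K) (m : nat) (m_gt0 : (0 < m)%N).
Local Notation Om := ('cV[order_ring O]_m).
Local Notation Km := ('cV[K]_m).
Context (n : nat) (w : 'I_n -> Om).
Hypothesis w_span : forall x : Km, exists c : 'I_n -> R,
  x = \sum_j (c j)%:A *: Oincl (w j).
Context (h : Om -> nat) (h_inj : injective h).
Context (mu : {measure set (borel_Km K m) -> \bar R}) (haar : is_haar mu).

Lemma mulmx_preimage_measurable (M : 'M[K]_m) (A : set (borel_Km K m)) :
  measurable A -> measurable ([set x : Km | A (M *m x)] : set (borel_Km K m)).
Proof.
move=> mA; rewrite -[X in measurable X]setTI.
apply: (measurability (f := fun x : borel_Km K m => M *m (x : Km) : borel_Km K m)
  (@open Km : set (set (borel_Km K m)))) => // _ [B oB <-].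
rewrite setTI; apply: open_borel; apply/(open_vnormP frm) => x /= Bx.
have [e e0 eB] := (open_vnormP frm _).1 oB _ Bx.
have [C C0 HC] := real_linear_bounded frm (mulmx_real_linear M).
exists (e / C); first by rewrite divr_gt0.
move=> y yx; apply: eB; rewrite -mulmxBr; apply: le_lt_trans (HC _) _.
by rewrite mulrC -ltr_pdivlMr.
Qed.

(** The measure is only known to be invariant under translations. That [k f] has
    covolume 1 follows from [covolume_le_of_norm_le], applied in both directions to
    [f] and [k f], which have the same norms. *)
Lemma unitary_marked1 (f : Om -> Km) (k : 'M[K]_m) :
  marked_lattice1 mu f -> unitary k ->
  marked_lattice1 mu (fun u => k *m f u).
Proof.
move=> [fm [F Fdom F1]] uk; have uk' := unitaryC uk.
have kfm : is_marked_lattice (fun u => k *m f u).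
  have [fD fZ [b bb fb]] := fm; split.
  - by move=> u v; rewrite fD mulmxDr.
  - by move=> u a; rewrite fZ rscale_mulmx.
  exists (k *m b).
    move=> x; have [c [xc cU]] := bb (adjmx k *m x); exists c; split.
      by rewrite -mulmxA -xc mulmxA uk mul1mx.
    by move=> c' xc'; apply: cU; rewrite xc' !mulmxA uk' mul1mx.
  apply/seteqP; split=> [_ [u _ <-]|_ [u _ <-]].
    have [v _ vE] : [set b *m Oincl u | u in [set: Om]] (f u) by rewrite -fb; exists u.
    by exists v => //; rewrite -mulmxA vE.
  have [v _ vE] : range f (b *m Oincl u) by rewrite fb; exists u.
  by exists v => //; rewrite -mulmxA vE.
pose G : set (borel_Km K m) := [set x : Km | F (adjmx k *m x)].
have Gdom : fundamental_domain (range (fun u => k *m f u)) G.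
  split; first exact: mulmx_preimage_measurable Fdom.1.
  move=> x; have [l [[[u _ ul] Fl] lU]] := Fdom.2 (adjmx k *m x).
  exists (k *m l); split.
    split; first by exists u => //; rewrite ul.
    by rewrite /G /= mulmxDr [_ *m (k *m l)]mulmxA uk' mul1mx.
  move=> _ [[v _ <-]]; rewrite /G /= mulmxDr [_ *m (k *m _)]mulmxA uk' mul1mx => Fv.
  by congr (_ *m _); apply: lU; split=> //; exists v.
have norm_kf u : vnorm (k *m f u) = vnorm (f u) by exact: vnorm_unitary.
have fB := marked_sub fm; have kfB := marked_sub kfm.
have f_inj := marked_inj frm fm; have kf_inj := marked_inj frm kfm.
have fco := marked_cocompact frm w_span fm.
have kfco := marked_cocompact frm w_span kfm.
have G_le1 : (mu G <= 1%:E)%E.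
  apply: (covolume_le_of_norm_le frm haar h_inj fB kf_inj Fdom Gdom fco F1) => u.
  by rewrite norm_kf.
have [a Ga] : exists a : R, mu G = a%:E.
  exists (fine (mu G)); rewrite fineK// ge0_fin_numE//.
  by apply: le_lt_trans G_le1 _; rewrite ltry.
split=> //; exists G => //; apply/eqP; rewrite eq_le G_le1 /=.
rewrite -F1 Ga.
apply: (covolume_le_of_norm_le frm haar h_inj kfB f_inj Gdom Fdom kfco Ga) => u.
by rewrite norm_kf.
Qed.

Lemma marked1_contraction (f g : Om -> Km) (c : R) :
  marked_lattice1 mu f -> marked_lattice1 mu g ->
  (forall u, vnorm (g u) ^+ 2 <= c * vnorm (f u) ^+ 2) -> 1 <= c.
Proof.
move=> [fm [F Fdom F1]] [gm [G Gdom G1]] fg.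
have : 1 <= Num.sqrt c.
  apply: (covolume_contraction frm haar h_inj (marked_sub fm) (marked_inj frm gm)
    Fdom Gdom (marked_cocompact frm w_span fm) m_gt0 F1 G1) => u.
  rewrite -[leLHS]ger0_norm ?vnorm_ge0// -sqrtr_sqr.
  rewrite -[vnorm (f u)]ger0_norm ?vnorm_ge0// -sqrtr_sqr mulrC -sqrtrM ?sqr_ge0//.
  by rewrite ler_wsqrtr// mulrC.
have [c0|c0] := leP 0 c; last by rewrite (ler0_sqrtr (ltW c0)) ler10.
by rewrite -[X in X <= _]sqrtr1 ler_sqrt.
Qed.

Local Notation X := (set_type (@marked_lattice1 R K O m mu)).
Implicit Types f g : X.

Lemma marked_val_matrix f :
  exists2 M, invertible_mx M & forall u, set_val f u = M *m Oincl u.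
Proof. exact: (marked_lattice_matrix frm (set_valP f).1). Qed.

(** Squares are compared, since they are what the Gram forms control, and the error
    is relative, since it has to be uniform in [u]. *)
Definition norms_close (e : R) f g := forall u : Om,
  `|vnorm (set_val g u : Km) ^+ 2 - vnorm (set_val f u : Km) ^+ 2|
     <= e * vnorm (set_val f u : Km) ^+ 2.

(** By [sqr_vnorm_close] the form of [g], scaled by [l], is close to that of [f];
    then [marked1_contraction], applied in both directions, shows that [l] is close
    to 1. *)
Lemma norms_close_of_projective f (e : R) : 0 < e <= 1 ->
  exists2 t : R, 0 < t & forall g (l : R), 0 < l ->
    (forall i j, `|l * vnorm (set_val g (w i + w j) : Km) ^+ 2
                 - vnorm (set_val f (w i + w j) : Km) ^+ 2| <= t) ->
    (forall i, `|l * vnorm (set_val g (w i) : Km) ^+ 2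
                 - vnorm (set_val f (w i) : Km) ^+ 2| <= t) ->
    norms_close e f g.
Proof.
move=> /andP[e0 e1]; have fX := set_valP f; pose d := e / 4.
have d0 : 0 < d by rewrite divr_gt0.
have d1 : d <= 1 / 4 by rewrite /d; lra.
have [N N_inv fE] := marked_val_matrix f.
have [t t0 Ht] := sqr_vnorm_close frm w_span N_inv d0.
exists t => // g l l0 Hij Hi; have gX := set_valP g.
have [M _ gE] := marked_val_matrix g.
have close u : `|l * vnorm (set_val g u : Km) ^+ 2 - vnorm (set_val f u : Km) ^+ 2|
    <= d * vnorm (set_val f u : Km) ^+ 2.
  by rewrite gE fE; apply: Ht => [i j|i]; rewrite -gE -fE.
have l_le : l <= 1 + d.
  have : 1 <= (1 + d) / l.
    apply: (marked1_contraction fX gX) => u.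
    have := close u; rewrite ler_norml => /andP[_ H].
    rewrite mulrAC ler_pdivlMr// mulrC; lra.
  by rewrite ler_pdivlMr// mul1r.
have l_ge : 1 - d <= l.
  have d1' : 0 < 1 - d by lra.
  have : 1 <= l / (1 - d).
    apply: (marked1_contraction gX fX) => u.
    have := close u; rewrite ler_norml => /andP[H _].
    rewrite mulrAC ler_pdivlMr// mulrC; lra.
  by rewrite ler_pdivlMr// mul1r.
move=> u; have := close u.
set q := vnorm (set_val g u : Km) ^+ 2; set a := vnorm (set_val f u : Km) ^+ 2.
have q0 : 0 <= q by rewrite exprn_ge0// vnorm_ge0.
have a0 : 0 <= a by rewrite exprn_ge0// vnorm_ge0.
rewrite !ler_norml => /andP[H1 H2].
have ed : e = 4 * d by rewrite /d; lra.
have lq_le : (1 - d) * q <= (1 + d) * a.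
  apply: le_trans (ler_wpM2r q0 l_ge) _; lra.
have lq_ge : (1 - d) * a <= (1 + d) * q.
  apply: le_trans _ (ler_wpM2r q0 l_le); lra.
have dda : d * d * a <= d * a / 4.
  rewrite mulrAC ler_wpM2l ?(mulr_ge0 (ltW d0))//; lra.
have da0 : 0 <= d * a := mulr_ge0 (ltW d0) a0.
have dda0 : 0 <= d * d * a := mulr_ge0 (mulr_ge0 (ltW d0) (ltW d0)) a0.
rewrite ed; apply/andP; split.
  have : (1 + d) * ((1 - 4 * d) * a) <= (1 + d) * q by apply: le_trans lq_ge; lra.
  rewrite ler_pM2l; last by lra.
  lra.
have : (1 - d) * q <= (1 - d) * ((1 + 4 * d) * a) by apply: le_trans lq_le _; lra.
rewrite ler_pM2l; last by lra.
lra.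
Qed.

End Markings.

(** * Cluster points of markings *)

Section Compactness.
Context {R : realType} {K : starAlgType R} (frm : parseval_frame K).
Context (O : subringClosed K) (m : nat) (m_gt0 : (0 < m)%N).
Local Notation Om := ('cV[order_ring O]_m).
Local Notation Km := ('cV[K]_m).
Context (n : nat) (w : 'I_n -> Om).
Hypothesis w_span : forall x : Km, exists c : 'I_n -> R,
  x = \sum_j (c j)%:A *: Oincl (w j).
Context (h : Om -> nat) (h_inj : injective h).
Context (mu : {measure set (borel_Km K m) -> \bar R}) (haar : is_haar mu).
Local Notation X := (set_type (@marked_lattice1 R K O m mu)).
Implicit Types f g : X.

Lemma isometric_of_eq_vnorm f g :
  (forall u : Om, vnorm (set_val g u : Km) = vnorm (set_val f u : Km)) ->
  isometric f g.
Proof.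
move=> fg; have [N N_inv fE] := marked_val_matrix frm f.
have [M _ gE] := marked_val_matrix frm g.
have [|k uk MkN] := unitary_of_eq_vnorm (M := M) frm w_span N_inv.
  by move=> u; rewrite -fE -gE fg.
by apply/asboolP; exists k => // u; rewrite fE gE MkN mulmxA.
Qed.

Section Cluster.
Variables (f : X) (U : set X).

Definition far_markings (e : R) : set {ptws Om -> Km} :=
  [set set_val g | g in [set g : X | norms_close e f g /\ ~ U g]].

(* This makes the filter below proper; [saturated_open_norms_close] refutes it. *)
Hypothesis far_neq0 : forall e : R, 0 < e <= 1 -> far_markings e !=set0.

Definition far_filter := filter_from [set e : R | 0 < e <= 1] far_markings.

Lemma far_filter_proper : ProperFilter far_filter.
Proof.
apply: filter_from_proper => //; apply: filter_from_filter.
  by exists 1; rewrite /= ltr01 lexx.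
move=> a b /andP[a0 a1] /andP[b0 b1]; exists (Num.min a b).
  by rewrite /= lt_min a0 b0 ge_min a1.
move=> _ [g [gc gU] <-]; split; exists g => //; split=> // u;
  by apply: le_trans (gc u) _; rewrite ler_wpM2r ?sqr_ge0// ge_min lexx ?orbT.
Qed.

(** All these markings take values in a product of compact balls. *)
Lemma far_filter_cluster : exists F : {ptws Om -> Km}, cluster far_filter F.
Proof.
have box := @compact_ptws_box Om Km
  (fun u => [set y : Km | vnorm y <= 2 * vnorm (set_val f u : Km)])
  (fun u => @closed_vball_compact R K frm m _).
have [|F [_ clF]] := box far_filter far_filter_proper; last by exists F.
exists 1; first by rewrite /= ltr01 lexx.
move=> _ [g [gc _] <-] u /=; have := gc u; rewrite ler_norml mul1r => /andP[_ H].
rewrite -ler_sqr ?nnegrE ?mulr_ge0 ?vnorm_ge0// exprMn.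
have := sqr_ge0 (vnorm (set_val f u : Km)); move: H; lra.
Qed.

Lemma cluster_approx (F : {ptws Om -> Km}) (e d : R) (s : seq Om) :
  cluster far_filter F -> 0 < e <= 1 -> 0 < d ->
  exists2 g : X, norms_close e f g &
    forall v, v \in s -> vnorm (set_val g v - F v : Km) < d.
Proof.
move=> clF e01 d0.
have near_s : nbhs F [set G : {ptws Om -> Km} |
    forall v, v \in s -> vnorm (G v - F v : Km) < d].
  elim: s => [|v s IH].
    have -> : [set G : {ptws Om -> Km} |
        forall v, v \in [::] -> vnorm (G v - F v : Km) < d] = setT.
      by apply/seteqP; split=> // G _ v.
    exact: filterT.
  have near_v : nbhs F [set G : {ptws Om -> Km} | vnorm (G v - F v : Km) < d].
    apply: (@ptws_eval_continuous Om Km v F [set y : Km | vnorm (y - F v) < d]).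
    by apply/(nbhs_vnormP frm); exists d.
  apply: filterS (filterI near_v IH) => G [Gv Gs] u.
  by rewrite inE => /predU1P[->//|/Gs].
have farE : far_filter (far_markings e) by exists e.
by have [_ [[g [gc _] <-] gs]] := clF _ _ farE near_s; exists g.
Qed.

Lemma cluster_vnorm (F : {ptws Om -> Km}) (u : Om) : cluster far_filter F ->
  vnorm (F u : Km) = vnorm (set_val f u : Km).
Proof.
move=> clF; apply/eqP; rewrite -subr_eq0; apply/eqP.
apply: (@norm_le_small_eq0 _ _ (1 + vnorm (set_val f u : Km))) => e e01.
have e0 : 0 < e by case/andP: e01.
have [g gc gs] := cluster_approx [:: u] clF e01 e0.
have := dist_le_of_sqr (vnorm_ge0 _) (vnorm_ge0 _) (gc u).
have := gs u (mem_head _ _); have := vnorm_dist frm (set_val g u) (F u).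
rewrite !ler_norml => /andP[? ?] ? /andP[? ?]; apply/andP; split; lra.
Qed.

(** [O]-linearity passes to the limit: it relates finitely many values at a
    time. *)
Lemma cluster_matrix (F : {ptws Om -> Km}) : cluster far_filter F ->
  exists M : 'M[K]_m, forall u, F u = M *m Oincl u.
Proof.
move=> clF; exists (\matrix_(i, j) (F (delta_mx j 0) : Km) i 0) => u.
set M := \matrix_(_, _) _.
have colM j : col j M = F (delta_mx j 0) by apply/colP => i; rewrite !mxE.
have /choice[C HC] : forall j : 'I_m, exists C : R, 0 < C /\ forall x : Km,
    vnorm (rscale x (oval (u j 0))) <= C * vnorm x.
  move=> j; have [C C0 HC] := real_linear_bounded frm (rscale_real_linear m (oval (u j 0))).
  by exists C.
apply/eqP; rewrite -subr_eq0; apply/eqP/vnorm_eq0.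
apply: (@norm_le_small_eq0 _ _ (1 + \sum_j C j)) => e e01.
have e0 : 0 < e by case/andP: e01.
have [g _ gs] := cluster_approx (u :: [seq delta_mx j 0 | j : 'I_m]) clF e01 e0.
have [N _ gE] := marked_val_matrix frm g.
have gu : vnorm (set_val g u - F u : Km) < e by apply: gs; rewrite mem_head.
have gd j : vnorm (set_val g (delta_mx j 0) - F (delta_mx j 0) : Km) < e.
  by apply: gs; rewrite inE; apply/orP; right; apply/mapP; exists j; rewrite ?mem_enum.
have -> : F u - M *m Oincl u = (F u - set_val g u)
    + \sum_j rscale (set_val g (delta_mx j 0) - F (delta_mx j 0)) (oval (u j 0)).
  have -> : \sum_j rscale (set_val g (delta_mx j 0) - F (delta_mx j 0)) (oval (u j 0))
      = (N - M) *m Oincl u.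
    rewrite mulmx_sum_rscale; apply: eq_bigr => j _; rewrite [in RHS]mxE.
    congr rscale; apply/colP => i.
    by rewrite gE Oincl_delta -colE !mxE.
  by rewrite mulmxBl -gE addrA subrK.
rewrite ger0_norm ?vnorm_ge0//; apply: le_trans (vnormD frm _ _) _.
rewrite mulrDr mulr1 lerD//; first by rewrite (vnorm_distC frm) ltW.
apply: le_trans (vnorm_sum frm _ _) _; rewrite mulr_sumr; apply: ler_sum => j _.
have [C0 HCj] := HC j; apply: le_trans (HCj _) _.
by rewrite mulrC ler_wpM2r// ltW.
Qed.

End Cluster.

(** Otherwise markings outside [U] whose norms tend to those of [f] would cluster
    in the product space, at a marking with exactly the norms of [f]. That
    marking is isometric to [f], so it lies in [U], which is open. *)
Lemma saturated_open_norms_close f (U : set X) : open U ->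
  (forall g g', isometric g g' -> U g -> U g') -> U f ->
  exists2 e : R, 0 < e <= 1 & forall g, norms_close e f g -> U g.
Proof.
move=> [V oV UV] Usat Uf; apply: contrapT => noe.
have far_neq0 (e : R) : 0 < e <= 1 -> far_markings f U e !=set0.
  move=> e01; apply: contrapT => far0; apply: noe; exists e => // g gc.
  by apply: contrapT => nUg; apply: far0; exists (set_val g); exists g.
have [F clF] := far_filter_cluster far_neq0.
have [M FE] := cluster_matrix clF.
have [N N_inv fE] := marked_val_matrix frm f.
have [|k uk MkN] := unitary_of_eq_vnorm (M := M) frm w_span N_inv.
  by move=> u; rewrite -fE -FE (cluster_vnorm u clF).
have FX : marked_lattice1 mu F.
  have -> : F = (fun u => k *m (set_val f u : Km)).
    by apply/funext => u; rewrite FE MkN fE mulmxA.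
  exact: (unitary_marked1 frm w_span h_inj haar (set_valP f) uk).
pose fk : X := exist _ F (mem_set FX).
have fkE : set_val fk = F by [].
have Ufk : U fk.
  apply: (Usat f) => //; apply/asboolP; exists k => // u.
  by rewrite fkE FE MkN fE mulmxA.
have VF : V F by move: Ufk; rewrite -UV /=.
have far1 : far_filter f U (far_markings f U 1).
  by exists 1; rewrite /= ?ltr01 ?lexx.
have [_ [[g [_ nUg] <-] Vg]] := clF _ _ far1 (open_nbhs_nbhs (conj oV VF)).
by apply: nUg; rewrite -UV.
Qed.

End Compactness.

(** * The embedding *)

Local Open Scope quotient_scope.

Lemma continuous_ptws (S : topologicalType) (I : Type) (T : topologicalType)
    (F : S -> {ptws I -> T}) :
  (forall i, continuous (fun x => F x i)) -> continuous F.
Proof.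
move=> Fc x; apply/cvg_sup => i; apply/cvg_image.
  by rewrite eqEsubset; split=> // t _; exists (fun=> t).
move=> A /= FA; exists ((fun f : {ptws I -> T} => f i) @^-1` A).
  exact: (Fc i x A FA).
by rewrite eqEsubset; split=> [_ [f Af <-]//|t At]; exists (fun=> t).
Qed.

Lemma continuous_set_type (S T : topologicalType) (A : set T)
    (F : S -> set_type A) : continuous (fun x => set_val (F x)) -> continuous F.
Proof.
move=> /continuousP Fc; apply/continuousP => _ [V oV <-].
exact: (Fc V oV).
Qed.

Lemma continuous_test (R : realType) (S : topologicalType) (x y : S -> R)
    (a b t : R) : continuous x -> continuous y ->
  continuous (fun s => t * y s - `|x s * a - b * y s|).
Proof.
move=> xc yc s; apply: cvgB; first by apply: cvgM; [exact: cvg_cst | exact: yc].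
apply: cvg_norm; apply: cvgB; apply: cvgM;
  by [exact: cvg_cst | exact: xc | exact: yc].
Qed.

Section Embedding.
Context {R : realType} {K : starAlgType R} (frm : parseval_frame K).
Context (O : subringClosed K) (m : nat) (m_gt0 : (0 < m)%N).
Local Notation Om := ('cV[order_ring O]_m).
Local Notation Km := ('cV[K]_m).
Context (n : nat) (w : 'I_n -> Om).
Hypothesis w_span : forall x : Km, exists c : 'I_n -> R,
  x = \sum_j (c j)%:A *: Oincl (w j).
Context (h : Om -> nat) (h_inj : injective h).
Context (mu : {measure set (borel_Km K m) -> \bar R}) (haar : is_haar mu).
Local Notation X := (set_type (@marked_lattice1 R K O m mu)).
Local Notation Cone := (set_type (@nonneg_cone R Om)).
Local Notation phi := (@phi R K O m mu m_gt0).
Implicit Types f g : X.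

Lemma norm_markedE f u :
  set_val (norm_marked m_gt0 f) u = vnorm (set_val f u : Km).
Proof. by []. Qed.

Lemma norm_marked_continuous : continuous (@norm_marked R K O m mu m_gt0).
Proof.
apply: continuous_set_type; apply: continuous_ptws => u f.
apply: (@continuous_comp X Km R (fun f : X => set_val f u) (@vnorm R K m)).
  apply: (@continuous_comp X {ptws Om -> Km} Km set_val (fun F => F u)).
    exact: initial_continuous.
  exact: ptws_eval_continuous.
exact: (vnorm_continuous frm).
Qed.

Lemma phi_continuous : continuous phi.
Proof.
apply/quotient_continuous.
have -> : phi \o \pi_(lattice_space mu) =
    \pi_(projective_cone R Om) \o @norm_marked R K O m mu m_gt0.
  by apply/funext => f; rewrite /= phiE.
move=> f; apply: continuous_comp; first exact: norm_marked_continuous.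
exact: pi_continuous.
Qed.

(** The ratio [c] of the two norms satisfies [c ^+ 2 >= 1] and [c ^- 2 >= 1] by
    [marked1_contraction], so the norms agree. *)
Lemma phi_injective : injective phi.
Proof.
move=> p q; rewrite -[p]reprK -[q]reprK !phiE.
set f := repr p; set g := repr q => /eqmodP/asboolP[c c0 fg].
have {}fg u : vnorm (set_val g u : Km) = c * vnorm (set_val f u : Km) by exact: fg.
have c1 : 1 <= c ^+ 2.
  apply: (marked1_contraction frm m_gt0 w_span h_inj haar (set_valP f) (set_valP g)) => u.
  by rewrite -exprMn -fg.
have c1' : 1 <= (c ^+ 2)^-1.
  apply: (marked1_contraction frm m_gt0 w_span h_inj haar (set_valP g) (set_valP f)) => u.
  by rewrite -[X in _ <= _ * X ^+ 2]/(vnorm (set_val g u : Km)) fg exprMn mulKf ?gt_eqF ?exprn_gt0.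
have {c1 c1'} c_eq : c = 1.
  apply/eqP; rewrite -(@pexpr_eq1 _ c 2) ?ltW// eq_le c1 andbT.
  by rewrite -invf_ge1 ?exprn_gt0.
apply/eqmodP; apply: (isometric_of_eq_vnorm frm w_span) => u.
by rewrite fg c_eq mul1r.
Qed.

Section ProjectiveNbhs.
Variables (f : X) (u0 : Om) (t : R).
Hypothesis t_gt0 : 0 < t.
Local Notation a v := (vnorm (set_val f v : Km) ^+ 2).

(** The vectors at which a norm is tested: those that determine the Gram matrix
    of the [w i] by polarization. *)
Definition test_vec (p : 'I_n * option 'I_n) : Om :=
  if p.2 is Some j then w p.1 + w j else w p.1.

(** Closeness to the norm of [f] after rescaling at [u0]; multiplied out, so as
    to be invariant under homotheties. *)
Definition projectively_close : set {ptws Om -> R} := [set H : {ptws Om -> R} |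
  0 < H u0 :> R /\ forall p, `|H (test_vec p) ^+ 2 * a u0
     - a (test_vec p) * H u0 ^+ 2| < t * H u0 ^+ 2 :> R].

Lemma projectively_close_open : open projectively_close.
Proof.
have open_pos (E : {ptws Om -> R} -> R) : continuous E -> open [set H | 0 < E H].
  by move=> /continuousP Ec; apply: (Ec [set x | 0 < x]); exact: open_gt.
have ev (v : Om) : continuous (fun H : {ptws Om -> R} => H v).
  exact: ptws_eval_continuous.
have ev2 (v : Om) : continuous (fun H : {ptws Om -> R} => H v ^+ 2).
  move=> H; apply: (@continuous_comp {ptws Om -> R} R R (fun G => G v) (fun x => x ^+ 2)).
    exact: ev.
  exact: exprn_continuous.
rewrite openE => H [H0 Hp]; apply: filterI.
  by apply: open_nbhs_nbhs; split=> //; exact: (open_pos _ (ev u0)).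
apply: (@filter_forall {ptws Om -> R} ('I_n * option 'I_n)%type (fun p =>
  [set H : {ptws Om -> R} | `|H (test_vec p) ^+ 2 * a u0
     - a (test_vec p) * H u0 ^+ 2| < t * H u0 ^+ 2]) (nbhs H)) => p.
apply: open_nbhs_nbhs; split; last exact: Hp.
have -> : [set H : {ptws Om -> R} | `|H (test_vec p) ^+ 2 * a u0
     - a (test_vec p) * H u0 ^+ 2| < t * H u0 ^+ 2] =
  [set H : {ptws Om -> R} | 0 < t * H u0 ^+ 2 - `|H (test_vec p) ^+ 2 * a u0
     - a (test_vec p) * H u0 ^+ 2|].
  by apply/seteqP; split=> G /=; rewrite subr_gt0.
apply: open_pos.
exact: (@continuous_test R {ptws Om -> R} (fun H => H (test_vec p) ^+ 2)
  (fun H => H u0 ^+ 2) (a u0) (a (test_vec p)) t (ev2 (test_vec p)) (ev2 u0)).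
Qed.

Lemma projectively_close_scale (G H : {ptws Om -> R}) (c : R) : 0 < c ->
  (forall u, H u = c * G u) -> projectively_close G -> projectively_close H.
Proof.
move=> c0 HG [G0 Gp]; split=> [|p]; rewrite !HG; first exact: mulr_gt0.
rewrite (_ : _ - _ = c ^+ 2 * (G (test_vec p) ^+ 2 * a u0 - a (test_vec p) * G u0 ^+ 2)).
  rewrite normrM gtr0_norm ?exprn_gt0// exprMn [ltRHS]mulrCA ltr_pM2l ?exprn_gt0//; exact: Gp.
by ring.
Qed.

End ProjectiveNbhs.

(** The scaling factor is the one that makes the two norms agree at [u0]. *)
Lemma test_vec_norms_close f (u0 : Om) (t : R) g :
  vnorm (set_val f u0 : Km) != 0 ->
  projectively_close f u0 t (set_val (norm_marked m_gt0 g)) ->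
  exists2 l : R, 0 < l & forall p,
    `|l * vnorm (set_val g (test_vec p) : Km) ^+ 2
      - vnorm (set_val f (test_vec p) : Km) ^+ 2| <= t.
Proof.
move=> fu0 [g0 gp]; rewrite norm_markedE in g0.
have g0' : 0 < vnorm (set_val g u0 : Km) ^+ 2 by rewrite exprn_gt0.
exists (vnorm (set_val f u0 : Km) ^+ 2 / vnorm (set_val g u0 : Km) ^+ 2).
  by rewrite divr_gt0// exprn_even_gt0.
move=> p; have := ltW (gp p); rewrite !norm_markedE.
rewrite -ler_pdivrMr// -[X in _ / X](gtr0_norm g0') -normrV ?unitfE ?gt_eqF//.
rewrite -normrM mulrBl mulfK ?gt_eqF//.
by rewrite [X in `|X - _|]mulrAC [X in `|X * _ - _|]mulrC -mulrA mulrC -[_ / _ * _]mulrC.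
Qed.

(** Around each point of the image of [U], a projective neighbourhood of the norm
    meets the range of [phi] inside this image. *)
Lemma phi_open_onto_image (U : set (lattice_space mu)) : open U ->
  exists2 V, open V & phi @` U = V `&` range phi.
Proof.
move=> oU; pose Vs := [set V : set (projective_cone R Om) |
  open V /\ V `&` range phi `<=` phi @` U].
exists (\bigcup_(V in Vs) V); first by apply: bigcup_open => V [].
apply/seteqP; split; last by move=> y [[V [_ VU] Vy] ry]; exact: VU.
move=> _ [q Uq <-]; split; last by exists q.
pose f := repr q; pose U' : set X := \pi_(lattice_space mu) @^-1` U.
have U'f : U' f by rewrite /U' /= /f reprK.
have U'sat g g' : isometric g g' -> U' g -> U' g'.
  move=> gg'; rewrite /U' /=.
  suff -> : \pi_(lattice_space mu) g' = \pi_(lattice_space mu) g by [].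
  by apply/esym/eqmodP.
have [e e01 eU] := saturated_open_norms_close frm w_span h_inj haar oU U'sat U'f.
have [t t0 tc] := norms_close_of_projective frm m_gt0 w_span h_inj haar f e01.
have [u0 fu0] := marked_lattice_neq0 m_gt0 (set_valP f).1.
have fu0' : vnorm (set_val f u0 : Km) != 0 by apply/eqP => /vnorm_eq0.
pose W := projectively_close f u0 t.
have Wsat (G H : Cone) : homothetic G H -> W (set_val G) -> W (set_val H).
  by move=> /asboolP[c c0 HG]; exact: projectively_close_scale HG.
pose V : set (projective_cone R Om) := [set y | W (set_val (repr y))].
have VE (H : Cone) : V (\pi_(projective_cone R Om) H) <-> W (set_val H).
  have HR : homothetic H (repr (\pi_(projective_cone R Om) H)).
    by apply/eqmodP; rewrite reprK.
  have RH : homothetic (repr (\pi_(projective_cone R Om) H)) H.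
    by apply/eqmodP; rewrite reprK.
  by split; exact: Wsat.
exists V; last first.
  rewrite -[q]reprK phiE; apply/VE; split.
    by rewrite norm_markedE lt_neqAle vnorm_ge0 andbT eq_sym.
  by move=> p; rewrite !norm_markedE subrr normr0 mulr_gt0// exprn_even_gt0.
split.
  rewrite /open /= /quotient_open (_ : _ @^-1` V = set_val @^-1` W).
    by exists W => //; exact: projectively_close_open.
  by apply/seteqP; split=> H /VE.
move=> y [Vy [p _ py]]; move: Vy; rewrite -py -[p]reprK phiE => /VE Wp.
exists (\pi_(lattice_space mu) (repr p)); last by rewrite phiE.
have [l l0 lt] := test_vec_norms_close fu0' Wp.
apply: (eU (repr p)); apply: (tc _ l l0) => [i j|i].
  exact: (lt (i, Some j)).
exact: (lt (i, None)).
Qed.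

End Embedding.

Theorem proposition2p6 (R : realType) (t : division_algebra)
    (O : subringClosed (carrier R t)) (hO : admissible_order O)
    (m : nat) (hm : (0 < m)%N)
    (mu : {measure set (borel_Km (carrier R t) m) -> \bar R})
    (hmu : normalized_haar O mu) :
  is_embedding (@phi R (carrier R t) O m mu hm).
Proof.
have frm : parseval_frame (carrier R t).
  by case: (t); [exact: real_frame | exact: complex_frame | exact: quaternion_frame].
have [haar _] := hmu.
have [n [g g_span]] := admissible_spanning hO.
have [h h_inj] := col_countable m (admissible_countable hO).
pose w (i : 'I_#|{: 'I_m * 'I_n}|) : 'cV[order_ring O]_m :=
  \col_k if k == (enum_val i).1 then g (enum_val i).2 else 0.
have w_span x : exists c : 'I_#|{: 'I_m * 'I_n}| -> R,
    x = \sum_j (c j)%:A *: Oincl (w j).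
  have [c xc] := col_real_spanning g_span x.
  exists (fun i => c (enum_val i)); rewrite xc.
  by rewrite (reindex (@enum_val _ xpredT))//=; apply: onW_bij; exact: enum_val_bij.
split.
- exact: (phi_injective frm w_span h_inj haar).
- exact: (phi_continuous frm).
- exact: (phi_open_onto_image frm hm w_span h_inj haar).
Qed.
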